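(* Let $0<\alpha\le\beta$ and let $f,g$ be arithmetic functions with $f(n)=O(n^{-\alpha})$ and $g(n)=O(n^{-\beta})$ for each $n\ge 1$. Let $F=f*1$ and $G=g*1$, with $F(n)=G(n)=0$ for $n\le 0$. Then, uniformly for all integers $h$ with $|h|\le x/2$, $$\sum_{H\le n\le x}F(n)G(n-h)=(x-H)\,C(h)+O\big(E(x;\alpha,\beta)\big),$$ where $H=1$ if $h\le 0$ and $H=h$ if $h>0$, $$C(h)=\sum_{\substack{a,b\ge 1\\ \gcd(a,b)\mid h}}\frac{f(a)g(b)}{[a,b]},$$ and the $O$-constant is absolute.
   Context: Here $f*1$ denotes the Dirichlet convolution with the constant function $1$, i.e. $F(n)=\sum_{d\mid n}f(d)$ and $G(n)=\sum_{d\mid n}g(d)$ for $n\ge1$; both are set equal to $0$ at integers $n\le 0$. $[a,b]$ is the least common multiple. The case $h=0$ is included; every positive integer divides $0$, so for $h=0$ the condition $\gcd(a,b)\mid h$ is always satisfied. The error function is $$E(x;\alpha,\beta)=\begin{cases}x^{1-\alpha}, & \alpha<\beta \text{ and } \alpha<1,\\ x^{1-\alpha}\log x, & \alpha=\beta<1,\\ \log x, & 1=\alpha<\beta,\\ \log^2 x, & \alpha=\beta=1,\\ 1, & 1<\alpha\le\beta.\end{cases}$$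
   Formalization: The O-constant is uniform in h, x and in f, g with given implied constants, but may depend on α, β and those implied constants (an absolute one is impossible: let α→1⁻ with h=0, β=2, g=1_{n=1}, f(n)=n^{-α}); x is taken to be at least 2, as E can vanish at x=1. *)

(* Defs.v *)
From mathcomp Require Export all_boot all_order all_algebra.
From mathcomp Require Export finmap.
From mathcomp Require Export complex.
From mathcomp Require Export boolp classical_sets reals topology normedtype exp.
From mathcomp Require Export summability.
Export Order.TTheory GRing.Theory Num.Theory numFieldNormedType.Exports.

Set Implicit Arguments.
Unset Strict Implicit.
Unset Printing Implicit Defensive.

Local Open Scope classical_set_scope.
Local Open Scope complex_scope.
Local Open Scope ring_scope.

(* Arithmetic functions are maps [f : nat -> R[i]] whose value at 0 is never
   used.  An inequality [`|z| <= r%:C] lives in R[i], where the norm takes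
   values; for real r it is the usual inequality of real numbers. *)

(* f * 1 on the positive integers, extended by 0 to the integers n <= 0. *)
Definition conv1 (R : realType) (f : nat -> R[i]) (n : int) : R[i] :=
  if 0 < n then \sum_(d <- divisors `|n|%N) f d else 0.

Definition bigO_pow (R : realType) (A alpha : R) (f : nat -> R[i]) : Prop :=
  forall n : nat, (0 < n)%N -> `|f n| <= (A * n%:R `^ (- alpha))%:C.

(* Summand of C(h), extended by 0 to the pairs (a, b) outside the range. *)
Definition Cterm (R : realType) (f g : nat -> R[i]) (h : int)
    (ab : nat * nat) : R[i]^o :=
  let: (a, b) := ab in
  if [&& (0 < a)%N, (0 < b)%N & ((gcdn a b)%:Z %| h)%Z]
  then f a * g b / (lcmn a b)%:R else 0.

(* The double series is the unordered sum: the limit of the sums over finite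
   sets of pairs, directed by inclusion.  In R[i] this limit exists exactly
   when the series converges absolutely. *)
Definition Cconverges (R : realType) (f g : nat -> R[i]) (h : int) : Prop :=
  cvg (partial_sum (Cterm f g h) @ totally).

Definition Cseries (R : realType) (f g : nat -> R[i]) (h : int) : R[i] :=
  summability.sum (Cterm f g h).

Definition Hstart (h : int) : int := if h <= 0 then 1 else h.

(* Only meant for alpha <= beta: [alpha < beta] failing means equality. *)
Definition Eerr (R : realType) (x alpha beta : R) : R :=
  if alpha < 1 then
    if alpha < beta then x `^ (1 - alpha) else x `^ (1 - alpha) * ln x
  else if alpha == 1 then
    if alpha < beta then ln x else ln x ^+ 2
  else 1.

(* The summation over the integers Hstart h <= n <= x; as Hstart h >= 1, it is
   enough to let n range over nat. *)
Definition shifted_sum (R : realType) (f g : nat -> R[i]) (x : R) (h : int)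
    : R[i] :=
  \sum_(0 <= n < (Num.truncn x).+1 | Hstart h <= n%:Z)
    conv1 f n%:Z * conv1 g (n%:Z - h).

(* Main.v *)
Require Import Defs.
From mathcomp Require Import sequences zify ring lra.

(** Let [h = i - j] with [i], [j >= 0] and one of them 0. Up to a vanishing term,
    the sum is that of [F (t + i) * G (t + j)] over [1 <= t <= T], where [T]
    differs from [x - H] by at most 1. Expanding [F] and [G] over divisors gives
    the sum over [a], [b] of [f a * g b * N], where [N = hits a b i j T] counts
    the [t] with [a %| t + i] and [b %| t + j]. These [t] form a residue class
    modulo [lcmn a b] if [gcdn a b] divides [h], and there are none otherwise.
    So [N] is within 1 of an expected number ([hits_approx]), and the expected
    numbers add up to the main term. Two estimates remain: that of the sum of
    [a ^ (- alpha) * b ^ (- beta) * |N - expected|] over a box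
    [1 <= a, b <= V] which holds all divisors that occur ([dev_Eerr]), and that of the tail of the
    series outside of this box ([sum_lcm_outside_box]).

    For [alpha >= 1], the bound 1 for each deviation suffices. For [alpha < 1]
    one may assume [beta < 1] as well, and takes [V = U ^ 2] of the order of [x].
    The bound 1 suffices for [a, b <= U], and more generally for
    [lcmn a b <= V] if one of [a], [b] is at most [U]. There are too many other
    pairs for that, and most of them are never hit. For these, the hits and the
    expected numbers are bounded separately, the hits being counted by passing to
    complementary divisors: [k = (t + i) / a] is at most
    [U] when [a > U]. For fixed [k] and [b], or for fixed [k] and
    [l = (t + j) / b], the [t] form a residue class again, now with a modulus
    that is small enough for its elements to be counted with their weights
    ([sum_gap]).

    The delicate case is [b <= U < a] with [alpha = beta]. Summing carelessly
    over the common divisors [e = gcdn k b], which divide [h], costs the sum of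
    [1 / e] over all divisors [e] of [h], which is not bounded. However,
    [lcmn a b > V >= k * a] means that [k * gcdn a b < b], and
    [g = gcd (h, b) = gcd (k * a, b)] divides [gcdn a b * e], so that
    [k * g < b * e]. This shorter range of [k] saves a factor [(g / e) ^ alpha]
    and leaves the sum of the [(e / g) ^ alpha] over the divisors [e] of [g],
    which is at most the sum of [d ^ (- alpha)] over the divisors [d] of [b]
    and is bounded on average over [b] ([sum_codivisors], [sum_sigma]).

    All these estimates are sums of negative powers of integers up to [U]. They
    are bounded by [U ^ (2 - 2 * alpha)] times the sum of the
    [u ^ (- 1 - beta + alpha)] for [u <= U] ([dev_bound]), and this last factor
    produces the logarithm when [alpha = beta]. *)

Set Implicit Arguments.
Unset Strict Implicit.
Unset Printing Implicit Defensive.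

Local Open Scope classical_set_scope.
Local Open Scope complex_scope.
Local Open Scope ring_scope.

(** * Sums over initial segments of the positive integers *)

Section Sums.
Variable R : realType.
Implicit Types (s p q x y : R) (N M d : nat).

(** All changes of summation variable below are inequalities between sums of
    nonnegative terms, so an injection of the index sets is enough; no
    bijection has to be produced. *)
Lemma ler_sum_inj (I J : eqType) (r : seq I) (r' : seq J) (P : pred I)
    (Q : pred J) (phi : I -> J) (F : I -> R) (G : J -> R) :
  uniq r -> uniq r' ->
  {in [seq i <- r | P i] &, injective phi} ->
  (forall i, i \in r -> P i -> [/\ phi i \in r', Q (phi i) & F i <= G (phi i)]) ->
  (forall j, Q j -> 0 <= G j) ->
  \sum_(i <- r | P i) F i <= \sum_(j <- r' | Q j) G j.
Proof.
move=> Ur Ur' phiI phiP G0.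
apply: (@le_trans _ _ (\sum_(j <- map phi [seq i <- r | P i]) G j)).
  rewrite big_map big_filter [leLHS]big_seq_cond [leRHS]big_seq_cond.
  by apply: ler_sum => i /andP[ir Pi]; case: (phiP i ir Pi).
rewrite -[leRHS]big_filter [leRHS](bigID (mem (map phi [seq i <- r | P i]))) /=.
rewrite -[leLHS]addr0 lerD //; last first.
  rewrite big_filter_cond; apply: sumr_ge0 => j /andP[Qj _]; exact: G0.
rewrite -[leRHS]big_filter; rewrite le_eqVlt; apply/predU1P; left; apply: perm_big => //=.
apply: uniq_perm; rewrite ?filter_uniq // ?map_inj_in_uniq ?filter_uniq //.
move=> j; rewrite mem_filter andb_idr // => /mapP[i + ->].
rewrite mem_filter => /andP[Pi ir].
by case: (phiP i ir Pi) => ? ? _; rewrite mem_filter; apply/andP.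
Qed.

Lemma ler_sum_nat_cond N (P : pred nat) (F G : nat -> R) :
  (forall n, (0 < n <= N)%N -> P n -> F n <= G n) ->
  \sum_(1 <= n < N.+1 | P n) F n <= \sum_(1 <= n < N.+1 | P n) G n.
Proof.
move=> FG; rewrite [leLHS]big_nat_cond [leRHS]big_nat_cond.
by apply: ler_sum => n /andP[nN Pn]; exact: FG.
Qed.

Lemma ler_sum_sub N (P Q : pred nat) (F : nat -> R) :
  (forall n, (0 < n <= N)%N -> P n -> Q n) -> (forall n, 0 <= F n) ->
  \sum_(1 <= n < N.+1 | P n) F n <= \sum_(1 <= n < N.+1 | Q n) F n.
Proof.
move=> PQ F0; apply: (@ler_sum_inj _ _ _ _ _ _ id); rewrite ?iota_uniq //.
by move=> n; rewrite mem_index_iota ltnS => nN Pn; split=> //; exact: PQ.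
Qed.

Lemma ler_sum_widen N M (P : pred nat) (F : nat -> R) :
  (N <= M)%N -> (forall n, 0 <= F n) ->
  \sum_(1 <= n < N.+1 | P n) F n <= \sum_(1 <= n < M.+1 | P n) F n.
Proof.
move=> NM F0; apply: (@ler_sum_inj _ _ _ _ _ _ id); rewrite ?iota_uniq //.
move=> n; rewrite !mem_index_iota !ltnS => /andP[n0 nN] Pn; split=> //.
by rewrite n0 (leq_trans nN).
Qed.

Lemma ler_sum_dvd N d (P : pred nat) (F : nat -> R) :
  (0 < d)%N -> (forall n, 0 <= F n) ->
  \sum_(1 <= n < N.+1 | (d %| n)%N && P n) F n <=
  \sum_(1 <= n < (N %/ d).+1 | P (d * n)%N) F (d * n)%N.
Proof.
move=> d0 F0; apply: (@ler_sum_inj _ _ _ _ _ _ (fun n => n %/ d)%N);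
  rewrite ?iota_uniq //.
- move=> m n; rewrite !mem_filter => /andP[/andP[dm _] _] /andP[/andP[dn _] _].
  by move=> /(congr1 (muln d)); rewrite ![(d * _)%N]mulnC !divnK.
- move=> n; rewrite !mem_index_iota !ltnS => /andP[n0 nN] /andP[dn Pn].
  rewrite [(d * _)%N]mulnC divnK // leq_div2r // divn_gt0 // dvdn_leq //.
Qed.

(** The switch to complementary divisors [k = n / a]: it trades a long range of
    [a] for a short range of [k]. *)
Lemma ler_sum_codvd N M n (P Q : pred nat) (F : nat -> R) :
  (0 < n)%N -> (forall m, 0 <= F m) ->
  (forall a, (0 < a <= N)%N -> (a %| n)%N -> P a ->
     (n %/ a <= M)%N && Q (n %/ a)%N) ->
  \sum_(1 <= a < N.+1 | (a %| n)%N && P a) F a <=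
  \sum_(1 <= k < M.+1 | (k %| n)%N && Q k) F (n %/ k)%N.
Proof.
move=> n0 F0 PQ.
have nK c : (c %| n)%N -> (n %/ (n %/ c))%N = c.
  move=> cn; have c0 := dvdn_gt0 n0 cn; rewrite -{1}(divnK cn) mulKn //.
  by rewrite divn_gt0 //; exact: dvdn_leq.
apply: (@ler_sum_inj _ _ _ _ _ _ (fun a => n %/ a)%N);
  rewrite ?iota_uniq //.
- move=> a b; rewrite !mem_filter => /andP[/andP[an _] _] /andP[/andP[bn _] _] e.
  by rewrite -(nK a an) e nK.
- move=> a; rewrite !mem_index_iota !ltnS => aN /andP[an Pa].
  have /andP[kM Qk] := PQ a aN an Pa; have a0 : (0 < a)%N by case/andP: aN.
  rewrite kM Qk andbT divn_gt0 // (dvdn_leq n0 an) (nK a an).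
  by split=> //; rewrite andbT; apply/dvdnP; exists a; rewrite mulnC divnK.
Qed.

End Sums.

(** * Negative powers and the partial sums of the zeta function *)

Definition negpow (R : realType) (s : R) (n : nat) : R := n%:R `^ (- s).

Definition zeta_sum (R : realType) (s : R) (N : nat) : R :=
  \sum_(1 <= n < N.+1) negpow s n.

Lemma negpow_ge0 (R : realType) (s : R) (n : nat) : 0 <= negpow s n.
Proof. exact: powR_ge0. Qed.
#[local] Hint Extern 0 (is_true (@Order.le _ _ _ (negpow _ _))) =>
  exact: negpow_ge0 : core.

Section NegPow.
Variable R : realType.
Implicit Types (s t p q x y : R) (N M d m n : nat).

Lemma negpow_gt0 s n : (0 < n)%N -> 0 < negpow s n.
Proof. by move=> n0; rewrite powR_gt0 // ltr0n. Qed.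

Lemma negpow1n s : negpow s 1 = 1.
Proof. by rewrite /negpow powR1. Qed.

Lemma negpowM s m n : negpow s (m * n) = negpow s m * negpow s n.
Proof. by rewrite /negpow natrM powRM. Qed.

Lemma negpowD s t n : (0 < n)%N -> negpow (s + t) n = negpow s n * negpow t n.
Proof. by move=> n0; rewrite /negpow opprD powRD // pnatr_eq0 -lt0n n0 implybT. Qed.

Lemma negpow0 n : negpow (0 : R) n = 1.
Proof. by rewrite /negpow oppr0 powRr0. Qed.

Lemma negpow1 n : negpow (1 : R) n = n%:R^-1.
Proof. by rewrite /negpow powR_inv1. Qed.

Lemma negpowN1 n : negpow (-1 : R) n = n%:R.
Proof. by rewrite /negpow opprK powRr1. Qed.

Lemma negpowN s n : (0 < n)%N -> negpow (- s) n = (negpow s n)^-1.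
Proof. by move=> n0; rewrite /negpow -powRN. Qed.

Lemma negpow_anti s m n : 0 <= s -> (0 < m <= n)%N -> negpow s n <= negpow s m.
Proof.
move=> s0 /andP[m0 mn]; rewrite /negpow !powRN lef_pV2 ?posrE ?powR_gt0 ?ltr0n //;
  last exact: leq_trans mn.
by rewrite ge0_ler_powR ?nnegrE // ler_nat.
Qed.

Lemma negpow_mono s m n : s <= 0 -> (m <= n)%N -> negpow s m <= negpow s n.
Proof.
move=> s0 mn; rewrite /negpow ge0_ler_powR ?nnegrE ?ler_nat //; lra.
Qed.

Lemma negpow_le s t n : (0 < n)%N -> s <= t -> negpow t n <= negpow s n.
Proof.
by move=> n0 st; rewrite /negpow ler_powR ?ler1n // lerN2.
Qed.

Lemma negpowS s n : (0 < n)%N ->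
  negpow s n = negpow s n.+1 * expR (- s * ln (1 - n.+1%:R^-1)).
Proof.
move=> n0; rewrite {1}/negpow.
have -> : n%:R = n.+1%:R * (1 - n.+1%:R^-1) :> R.
  by rewrite mulrBr mulr1 divff ?pnatr_eq0 // -natr1 addrK.
have y1 : n.+1%:R^-1 < 1 :> R by rewrite invf_lt1 ?ltr0n // ltr1n ltnS.
rewrite powRM ?ler0n ?subr_ge0 1?ltW // {2}/powR ifF //.
by apply/negbTE; rewrite gt_eqF // subr_gt0.
Qed.

Let ln_lt n : (0 < n)%N -> ln (1 - n.+1%:R^-1) <= - n.+1%:R^-1 :> R.
Proof.
move=> n0; apply: le_ln1Dx.
by rewrite ltrN2 invf_lt1 ?ltr0n // ltr1n ltnS.
Qed.

(** Up to a constant, [t ^ (- s)] is at most the increment of its primitive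
    [t ^ (1 - s)], so that sums of powers telescope and no integral is needed. *)
Lemma negpow_le_increment s n : 0 <= s -> s < 1 ->
  negpow s n.+1 <= 2 / (1 - s) * (negpow (s - 1) n.+1 - negpow (s - 1) n).
Proof.
move=> s0 s1; have d0 : 0 < 1 - s by lra.
have C0 : 0 < 2 / (1 - s) by rewrite divr_gt0.
case: n => [|n].
  rewrite !negpow1n {1}/negpow powR0 ?subr0 ?mulr1; last by apply/eqP; lra.
  by rewrite ler_pdivlMr //; lra.
set N := n.+2; set v := negpow (s - 1) n.+2.
have y0 : 0 < (N%:R : R)^-1 by rewrite invr_gt0 ltr0n.
have y1 : (N%:R : R)^-1 <= 1 by rewrite invf_le1 ?ltr0n // ler1n.
have -> : negpow s N = v * N%:R^-1.
  by rewrite -negpow1 -negpowD // subrK.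
rewrite [negpow (s - 1) n.+1]negpowS // -/N -/v.
set E := expR _; have -> a : a * (v - v * E) = v * (a * (1 - E)) by ring.
apply: ler_wpM2l; first exact: negpow_ge0.
suff EE : E <= 1 - (1 - s) * N%:R^-1 / 2.
  rewrite -ler_pdivrMl // invf_div; move: EE; lra.
have : E <= expR (- ((1 - s) * N%:R^-1)).
  rewrite ler_expR; have := ln_lt (ltn0Sn n); rewrite -/N => H.
  by rewrite -mulrN (_ : - (s - 1) = 1 - s) ?opprB // ler_pM2l.
move=> /le_trans; apply.
set z := (1 - s) * _; have z0 : 0 <= z by rewrite mulr_ge0 // ltW.
have z1 : z <= 1.
  by rewrite -[leRHS]mulr1; apply: ler_pM => //; lra.
rewrite expRN -[leLHS]mul1r ler_pdivrMr ?expR_gt0 //.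
apply: (@le_trans _ _ ((1 - z / 2) * (1 + z))); first nra.
by rewrite ler_wpM2l ?expR_ge1Dx //; lra.
Qed.

(** The same comparison for exponents beyond 1, where the primitive decreases. *)
Lemma negpow_le_decrement p n : 0 < p -> (0 < n)%N ->
  negpow (1 + p) n.+1 <= p^-1 * (negpow p n - negpow p n.+1).
Proof.
move=> p0 n0; set v := negpow p n.+1.
have -> : negpow (1 + p) n.+1 = v * n.+1%:R^-1.
  by rewrite -negpow1 -negpowD // addrC.
rewrite negpowS // -/v; set E := expR _.
have -> a : a * (v * E - v) = v * (a * (E - 1)) by ring.
apply: ler_wpM2l; first exact: negpow_ge0.
rewrite ler_pdivlMl // lerBrDr addrC; apply: le_trans (expR_ge1Dx _) _; rewrite ler_expR.
have := ln_lt n0; rewrite mulNr -mulrN ler_pM2l // lerNr.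
by [].
Qed.

Lemma zeta_sum_ge0 s N : 0 <= zeta_sum s N.
Proof. by apply: sumr_ge0. Qed.

Lemma zeta_sum_ge1 s N : (0 < N)%N -> 1 <= zeta_sum s N.
Proof.
move=> N0; rewrite /zeta_sum big_ltn // negpow1n lerDl sumr_ge0 //.
Qed.

Lemma zeta_sum_le_widen s N M : (N <= M)%N -> zeta_sum s N <= zeta_sum s M.
Proof. by move=> NM; apply: ler_sum_widen. Qed.

Lemma zeta_sum_lt1 s N : 0 <= s -> s < 1 -> zeta_sum s N <= 2 / (1 - s) * negpow (s - 1) N.
Proof.
move=> s0 s1; have d0 : 0 < 1 - s by lra.
elim: N => [|N IH].
  by rewrite /zeta_sum big_geq // mulr_ge0 // divr_ge0 // ltW.
rewrite /zeta_sum big_nat_recr //= -/(zeta_sum s N).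
by have := negpow_le_increment N s0 s1; lra.
Qed.

Lemma zeta_sum_tail p N M : 0 < p -> (0 < N)%N ->
  \sum_(1 <= n < M.+1 | (N < n)%N) negpow (1 + p) n <= p^-1 * negpow p N.
Proof.
move=> p0 N0; have pV0 : 0 < p^-1 by rewrite invr_gt0.
suff H : \sum_(1 <= n < M.+1 | (N < n)%N) negpow (1 + p) n
          <= p^-1 * (negpow p N - negpow p (maxn N M)).
  by apply: le_trans H _; rewrite ler_pM2l // gerBl.
elim: M => [|M IH].
  by rewrite big_geq // maxn0 subrr mulr0.
rewrite big_mkcond big_nat_recr // -big_mkcond; case: ifP => NM; rewrite ?NM.
  have MN : maxn N M = M by apply/maxn_idPr.
  have -> : maxn N M.+1 = M.+1 by apply/maxn_idPr; apply: ltnW.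
  have := @negpow_le_decrement p M p0 (leq_trans N0 NM).
  by move: IH; rewrite MN /=; lra.
move: IH; rewrite (maxn_idPl _) ?(maxn_idPl _); last 2 first.
- by rewrite leqNgt NM.
- by rewrite ltnW // ltnNge -ltnS NM.
by rewrite /= addr0.
Qed.

(** The cut is at the real number [V / b]. The powers of [V] and of [b] are kept
    apart because the bound gets summed over [b]. *)
Lemma zeta_sum_tail_div p V b M : 0 < p -> (0 < V)%N -> (0 < b)%N ->
  \sum_(1 <= n < M.+1 | (V < n * b)%N) negpow (1 + p) n <=
  (1 + p^-1) * (negpow p V * negpow (- p) b).
Proof.
move=> p0 V0 b0.
set u := (V %/ b).+1.
have uV : (V < u * b)%N by rewrite -ltn_divLR.
apply: (@le_trans _ _ ((1 + p^-1) * negpow p u)); last first.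
  rewrite ler_pM2l; last by rewrite ltr_wpDr ?invr_ge0 ?ltW.
  rewrite (negpowN p) // ler_pdivlMr ?negpow_gt0 //.
  by rewrite -negpowM negpow_anti ?ltW //; lia.
have -> : \sum_(1 <= n < M.+1 | (V < n * b)%N) negpow (1 + p) n =
   \sum_(1 <= n < M.+1 | (u <= n)%N) negpow (1 + p) n.
  by apply: eq_bigl => n; rewrite -ltn_divLR.
rewrite (bigID (fun n => n == u)) /= mulrDl mul1r lerD //.
  apply: (@le_trans _ _ (\sum_(1 <= n < M.+1 | n == u) negpow (1 + p) n)).
    by apply: ler_sum_sub => // n _ /andP[].
  rewrite big_nat1_eq; case: ifP => // _; apply: negpow_le => //; lra.
apply: le_trans (zeta_sum_tail M p0 (ltn0Sn _)).
by apply: ler_sum_sub => // n _; lia.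
Qed.

Lemma zeta_sum_gt1 p N : 0 < p -> zeta_sum (1 + p) N <= 1 + p^-1.
Proof.
move=> p0; case: N => [|N]; first by rewrite /zeta_sum big_geq // addr_ge0 // invr_ge0 ltW.
rewrite /zeta_sum big_ltn // negpow1n lerD2l.
apply: le_trans (_ : \sum_(1 <= n < N.+2 | (1 < n)%N) negpow (1 + p) n <= _).
  apply: (@ler_sum_inj _ _ _ _ _ _ _ id); rewrite ?iota_uniq // => n.
  by rewrite !mem_index_iota => /andP[n2 nN]; rewrite n2 nN ltnW.
by apply: le_trans (zeta_sum_tail _ p0 _) _ => //; rewrite negpow1n mulr1.
Qed.

Let inv_le_lnB n : (0 < n)%N -> n.+1%:R^-1 <= ln n.+1%:R - ln n%:R :> R.
Proof.
move=> n0; have := ln_lt n0.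
have -> : 1 - n.+1%:R^-1 = n%:R / n.+1%:R :> R.
  apply: (@mulIf _ n.+1%:R); first by rewrite pnatr_eq0.
  by rewrite mulfVK ?pnatr_eq0 // mulrBl mulVf ?pnatr_eq0 // mul1r -natr1 addrK.
by rewrite ln_div ?posrE ?ltr0n // lerNr opprB.
Qed.

Lemma zeta_sum_harmonic N : (1 < N)%N -> zeta_sum 1 N <= (1 + (ln 2)^-1) * ln (N%:R : R).
Proof.
move=> N1.
have ln2 : 0 < ln 2 :> R by rewrite ln_gt0 // ltr1n.
have lnN : ln 2 <= ln (N%:R) :> R by rewrite ler_ln ?posrE ?ltr0n ?ler_nat // ltnW.
apply: (@le_trans _ _ (1 + ln (N%:R : R))); last first.
  rewrite mulrDl mul1r addrC lerD2l.
  by rewrite ler_pdivlMl // mulr1.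
elim: N N1 {lnN} => // -[|N] // IH _.
rewrite /zeta_sum big_nat_recr //= negpow1.
case: N IH => [|N] IH.
  rewrite big_nat1 negpow1n lerD2l.
  have : 2^-1 <= ln (2%:R) :> R.
    have := @le_ln1Dx R (- 2^-1); rewrite (_ : 1 + - 2^-1 = 2^-1); last by field.
    rewrite lnV ?posrE //; lra.
  by [].
have {IH} := IH isT; have := inv_le_lnB (ltn0Sn N.+1).
move=> h1 h2; apply: le_trans (lerD h2 h1) _.
by rewrite -addrA subrKC.
Qed.

Lemma zeta_sum_lt1_div s V b : 0 <= s -> s < 1 -> (0 < b)%N ->
  zeta_sum s (V %/ b) <= 2 / (1 - s) * (negpow (s - 1) V * negpow (1 - s) b).
Proof.
move=> s0 s1 b0; apply: le_trans (zeta_sum_lt1 _ s0 s1) _.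
have d0 : 0 < 1 - s by lra.
rewrite ler_pM2l ?divr_gt0 // -(opprB s 1) negpowN // ler_pdivlMr ?negpow_gt0 //.
by rewrite -negpowM negpow_mono ?leq_divM //; lra.
Qed.

End NegPow.

#[local] Hint Extern 0 (is_true (@Order.le _ _ _ (zeta_sum _ _))) =>
  exact: zeta_sum_ge0 : core.

(** * Counting the common solutions of two divisibilities *)

Definition hits (a b i j T : nat) : nat :=
  (\sum_(1 <= t < T.+1 | (a %| t + i) && (b %| t + j)) 1)%N.

Section Congruences.
Local Open Scope nat_scope.

Lemma crt_shift0 a b j : 0 < b -> gcdn a b %| j ->
  exists c, (a %| c) && (c == j %[mod b]).
Proof.
move=> b0 /dvdnP[m ->]; case: (posnP a) => [->|a0].
  exists 0; rewrite gcd0n -modnMmr modnn muln0 mod0n dvdn0 //=.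
case: (egcdnP b a0) => ka kb e _.
exists (m * (ka * a)); rewrite dvdn_mull ?dvdn_mull //=.
by rewrite e mulnDr mulnA modnMDl.
Qed.

(** The Chinese remainder theorem for moduli that need not be coprime: a common
    shift [c] turns the two divisibilities into a single one. As [i] or [j] is
    0, [gcdn a b %| i + j] says that the two congruences are compatible. *)
Lemma crt_shift a b i j : 0 < a -> 0 < b -> i = 0 \/ j = 0 ->
  gcdn a b %| i + j ->
  exists c, forall t, (a %| t + i) && (b %| t + j) = (lcmn a b %| t + c).
Proof.
move=> a0 b0.
have eqd d t k c : c = k %[mod d] -> (d %| t + k) = (d %| t + c).
  by move=> e; rewrite /dvdn -modnDmr -e modnDmr.
case=> ->; rewrite ?add0n ?addn0 => g.
  have [c /andP[ac /eqP cj]] := crt_shift0 b0 g.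
  exists c => t; rewrite dvdn_lcm (eqd b t j c cj); congr (_ && _).
  by apply: eqd; apply/eqP; rewrite mod0n.
rewrite gcdnC in g.
have [c /andP[bc /eqP ci]] := crt_shift0 a0 g.
exists c => t; rewrite dvdn_lcm (eqd a t i c ci); congr (_ && _).
by apply: eqd; apply/eqP; rewrite mod0n.
Qed.

(** Since [i] or [j] is 0, [b %| t + j] makes [t + i] congruent to
    [i + j] or to [- (i + j)] modulo [b]. *)
Lemma gcdn_shift b i j t : i = 0 \/ j = 0 -> b %| t + j ->
  gcdn (t + i) b = gcdn (i + j) b.
Proof.
case=> ->; rewrite ?add0n ?addn0 => bt.
  have e d : d %| b -> (d %| t) = (d %| j).
    by move=> db; apply: dvdn_add_eq; apply: dvdn_trans bt.
  apply/eqP; rewrite eqn_dvd !dvdn_gcd !dvdn_gcdr !andbT.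
  by rewrite -e ?dvdn_gcdr // dvdn_gcdl e ?dvdn_gcdr // dvdn_gcdl.
by case/dvdnP: bt => k ->; rewrite gcdnC gcdnMDl gcdnC.
Qed.

Lemma hits_eq0 a b i j T : i = 0 \/ j = 0 -> ~~ (gcdn a b %| i + j) ->
  hits a b i j T = 0.
Proof.
move=> ij g; rewrite /hits big1_seq // => t /andP[/andP[at_ bt] _].
case/negP: g.
have := gcdn_shift ij bt; have : gcdn a b %| gcdn (t + i) b.
  by rewrite dvdn_gcd dvdn_gcdr (dvdn_trans (dvdn_gcdl _ _) at_).
by move=> + e; rewrite e dvdn_gcd => /andP[].
Qed.

(** A step of [t] raises the quotient by 1 exactly when it meets a multiple of
    [L]. This counts a residue class in an interval, wherever it starts. *)
Lemma hits_telescope L c T : 0 < L ->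
  \sum_(1 <= t < T.+1 | L %| t + c) 1 + c %/ L = (T + c) %/ L.
Proof.
move=> L0; elim: T => [|T IH]; first by rewrite big_geq.
rewrite big_mkcond big_nat_recr // -big_mkcond /= addSn divnS // -IH.
by case: (L %| _); rewrite ?addn0 // addn1 addSn.
Qed.

Lemma gap_lcm a b i j t t' : a %| t + i -> b %| t + j -> a %| t' + i -> b %| t' + j ->
  t < t' -> lcmn a b <= t' - t.
Proof.
move=> h1 h2 h3 h4 tt'; apply: dvdn_leq; first by rewrite subn_gt0.
rewrite dvdn_lcm; apply/andP; split; first by rewrite -(subnDr i) dvdn_sub.
by rewrite -(subnDr j) dvdn_sub.
Qed.

End Congruences.

Section Density.
Variable R : realType.
Implicit Types (s t p q x y : R) (N M d m n : nat).

(** When the two congruences are compatible, they define a single residue class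
    modulo [lcmn a b]. *)
Definition expected (a b i j T : nat) : R :=
  if (gcdn a b %| i + j)%N then T%:R / (lcmn a b)%:R else 0.

Lemma expected_ge0 a b i j T : 0 <= expected a b i j T.
Proof. by rewrite /expected; case: ifP => // _; rewrite divr_ge0. Qed.

Lemma hits_approx a b i j T : (0 < a)%N -> (0 < b)%N -> i = 0%N \/ j = 0%N ->
  `|(hits a b i j T)%:R - expected a b i j T| <= 1.
Proof.
move=> a0 b0 ij; rewrite /expected; case: ifPn => g; last first.
  by rewrite hits_eq0 // subrr normr0.
have [c hc] := crt_shift a0 b0 ij g.
set L := lcmn a b; have L0 : (0 < L)%N by rewrite lcmn_gt0 a0.
have e : (hits a b i j T + c %/ L = (T + c) %/ L)%N.
  by rewrite -hits_telescope //; congr (_ + _)%N; apply: eq_bigl => t; rewrite hc.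
set h := hits _ _ _ _ _ in e *.
have h1 : (h * L <= T + L)%N.
  have : ((h + c %/ L) * L <= T + c)%N by rewrite e leq_divM.
  have := ltn_ceil c L0; lia.
have h2 : (T <= h * L + L)%N.
  have := ltn_ceil (T + c) L0; rewrite -e mulSn mulnDl.
  have := leq_divM c L; lia.
have LR : 0 < L%:R :> R by rewrite ltr0n.
have y : T%:R / L%:R * L%:R = T%:R :> R by rewrite divfK ?gt_eqF.
have h1R : h%:R * L%:R <= T%:R + L%:R :> R by rewrite -natrM -natrD ler_nat.
have h2R : T%:R <= h%:R * L%:R + L%:R :> R by rewrite -natrM -natrD ler_nat.
by rewrite ler_norml; apply/andP; split; rewrite -(ler_pM2r LR); lra.
Qed.

End Density.

(** * Sums over sparse sets and sums with a greatest common divisor *)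

Lemma lcm_divgcd a b : lcmn a b = (a %/ gcdn a b * b)%N.
Proof. by rewrite /lcmn divn_mulAC ?dvdn_gcdl. Qed.

Section SparseSums.
Variable R : realType.
Implicit Types (s t p q x y : R) (N M d m n : nat).

Lemma ler_sum_term N (P : pred nat) (F : nat -> R) n :
  (0 < n <= N)%N -> P n -> (forall m, 0 <= F m) ->
  F n <= \sum_(1 <= m < N.+1 | P m) F m.
Proof.
move=> nN Pn F0; have -> : F n = \sum_(m <- [:: n]) F m by rewrite big_seq1.
apply: (@ler_sum_inj _ _ _ _ _ _ _ id); rewrite ?iota_uniq // => m.
by rewrite inE => /eqP ->; rewrite mem_index_iota ltnS.
Qed.

Lemma ler_sum_le1 N (P : pred nat) (F : nat -> R) D : 0 <= D ->
  (forall m n, P m -> P n -> (m < n)%N -> False) ->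
  (forall n, (0 < n <= N)%N -> P n -> F n <= D) ->
  \sum_(1 <= n < N.+1 | P n) F n <= D.
Proof.
move=> D0 P1; elim: N => [|N IH] FD; first by rewrite big_geq.
rewrite big_mkcond big_nat_recr // -big_mkcond /=; case: ifPn => PN.
  rewrite big_nat_cond big1 ?add0r ?FD ?leqnn // => n /andP[/andP[_ nN] Pn].
  by case: (P1 n N.+1).
by rewrite addr0 IH // => n /andP[n0 nN]; apply: FD; rewrite n0 ltnW.
Qed.

(** The indices may form, for instance, a residue class modulo [L]. For
    [L <= n + i], the term [negpow s (n + i)] is at most the mean of
    [negpow s] over the [L] integers up to [n + i], and these blocks are
    disjoint. Below [L] there is at most one term, which can be much larger
    than the mean; this is why it has the separate bound [D]. *)
Lemma sum_gap (P : pred nat) (F : nat -> R) L i T V s C D :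
  (0 < L)%N -> 0 <= s -> 0 <= C -> 0 <= D -> (T + i <= V)%N ->
  (forall m n, P m -> P n -> (m < n)%N -> (L <= n - m)%N) ->
  (forall n, (0 < n <= T)%N -> P n -> F n <= D) ->
  (forall n, (0 < n <= T)%N -> P n -> F n <= C * negpow s (n + i)) ->
  \sum_(1 <= n < T.+1 | P n) F n <= D + C * L%:R^-1 * zeta_sum s V.
Proof.
move=> L0 s0 C0 D0 TV gap FD FC.
rewrite (bigID (fun n => L <= n + i)%N) /= addrC lerD //.
  apply: ler_sum_le1 => // [m n /andP[Pm _] /andP[Pn nL] mn|n nT /andP[Pn _]].
    by have := gap m n Pm Pn mn; lia.
  exact: FD.
have L0R : 0 < L%:R :> R by rewrite ltr0n.
rewrite mulrAC ler_pdivlMr // mulr_suml.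
(* Each term is replaced by a block of L terms, indexed by u. *)
apply: (@le_trans _ _ (\sum_(1 <= n < T.+1 | P n && (L <= n + i)%N)
    C * \sum_(1 <= u < V.+1 | (u <= n + i < u + L)%N) negpow s u)).
  apply: ler_sum_nat_cond => n nT /andP[Pn Ln].
  apply: (@le_trans _ _ (C * negpow s (n + i) * L%:R)).
    by rewrite ler_pM2r // FC.
  rewrite -mulrA ler_wpM2l //.
  have -> : negpow s (n + i) * L%:R = \sum_((n + i).+1 - L <= u < (n + i).+1) negpow s (n + i).
    by rewrite sumr_const_nat subKn ?mulr_natr // ltnW.
  apply: (@ler_sum_inj _ _ _ _ _ _ _ id); rewrite ?iota_uniq // => u.
  rewrite !mem_index_iota => /andP[u1 u2] _; split; try lia.
  by apply: negpow_anti => //; lia.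
rewrite -mulr_sumr ler_wpM2l //.
rewrite (exchange_big_dep xpredT) //= /zeta_sum; apply: ler_sum => u _.
apply: ler_sum_le1 => // m n /andP[/andP[Pm _] mu] /andP[/andP[Pn _] nu] mn.
by have := gap m n Pm Pn mn; lia.
Qed.

(** Sorting the [a] by [d = gcdn a b], which divides [b], makes the cofactor
    [a %/ d] a free variable: its coprimality to [b %/ d] can be dropped. *)
Lemma sum_gcd_split b N (G : nat -> nat -> R) :
  (0 < b)%N -> (forall d a, 0 <= G d a) ->
  \sum_(1 <= a < N.+1) G (gcdn a b) (a %/ gcdn a b)%N <=
  \sum_(1 <= d < b.+1 | (d %| b)%N) \sum_(1 <= a < N.+1) G d a.
Proof.
move=> b0 G0.
apply: (@le_trans _ _ (\sum_(1 <= a < N.+1)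
   \sum_(1 <= d < b.+1 | (d %| b)%N && (d %| a)%N) G d (a %/ d)%N)).
  apply: ler_sum => a _.
  apply: (ler_sum_term (F := fun d => G d (a %/ d)%N)) => //.
    by rewrite gcdn_gt0 b0 orbT dvdn_leq // dvdn_gcdr.
  by rewrite dvdn_gcdl dvdn_gcdr.
rewrite (exchange_big_dep (fun d => d %| b)%N) /=; last by move=> a d _ /andP[].
apply: ler_sum_nat_cond => d /andP[d0 _] db; rewrite db /=.
apply: le_trans (_ : \sum_(1 <= a < N.+1 | (d %| a)%N && true) G d (a %/ d)%N <= _).
  by apply: ler_sum_sub => // n _ ->.
apply: le_trans (ler_sum_dvd (F := fun a => G d (a %/ d)%N) _ _ d0 _) _ => //.
rewrite /=.
rewrite (eq_bigr (fun a => G d a)); last by move=> a _; rewrite mulKn.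
by apply: ler_sum_widen => //; exact: leq_div.
Qed.

(** A gcd is at most the sum of all common divisors; exchanging the sums then
    decouples the two variables. *)
Lemma sum_gcd_mul M (u v : nat -> R) :
  (forall n, 0 <= u n) -> (forall n, 0 <= v n) ->
  \sum_(1 <= a < M.+1) \sum_(1 <= b < M.+1) (gcdn a b)%:R * (u a * v b) <=
  \sum_(1 <= d < M.+1) d%:R * ((\sum_(1 <= a < (M %/ d).+1) u (d * a)%N) *
                               (\sum_(1 <= b < (M %/ d).+1) v (d * b)%N)).
Proof.
move=> u0 v0.
apply: (@le_trans _ _ (\sum_(1 <= a < M.+1) \sum_(1 <= b < M.+1)
   \sum_(1 <= d < M.+1 | (d %| a)%N && (d %| b)%N) d%:R * (u a * v b))).
  apply: ler_sum_nat_cond => a /andP[a0 aM] _; apply: ler_sum => b _.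
  apply: (ler_sum_term (F := fun d => d%:R * (u a * v b))) => //.
  - by rewrite gcdn_gt0 a0 (leq_trans _ aM) // dvdn_leq // dvdn_gcdl.
  - by rewrite dvdn_gcdl dvdn_gcdr.
  - by move=> m; rewrite !mulr_ge0.
under eq_bigr do rewrite (exchange_big_dep xpredT) //=.
rewrite exchange_big /=.
apply: ler_sum_nat_cond => d /andP[d0 dM] _.
apply: (@le_trans _ _ (d%:R * ((\sum_(1 <= a < M.+1 | (d %| a)%N && true) u a) *
                               (\sum_(1 <= b < M.+1 | (d %| b)%N && true) v b)))).
  rewrite big_distrlr mulr_sumr /= [leRHS]big_mkcond /=.
  apply: ler_sum => a _; case: ifP => [/andP[da _]|da].
    rewrite mulr_sumr da; apply: ler_sum_sub => [b _|b]; first by rewrite andbT.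
    by rewrite !mulr_ge0.
  by rewrite big1 // => b; rewrite andbT in da; rewrite da.
rewrite ler_wpM2l // ler_pM ?sumr_ge0 // ; exact: ler_sum_dvd.
Qed.

End SparseSums.

(** * Sums over one variable with the other one fixed *)

Lemma dvdn_gcd_mul a k b : (gcdn (k * a) b %| gcdn k b * gcdn a b)%N.
Proof.
rewrite muln_gcdr dvdn_gcd muln_gcdl dvdn_gcd dvdn_gcdl /= dvdn_mulr ?dvdn_gcdr //.
by rewrite dvdn_mull ?dvdn_gcdr.
Qed.

Section Mixed.
Variable R : realType.
Implicit Types (s t p q x y : R) (N M d m n : nat).

Definition sigma (p : R) (b : nat) : R :=
  \sum_(1 <= d < b.+1 | (d %| b)%N) negpow p d.

Lemma sigma_ge0 p b : 0 <= sigma p b.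
Proof. by apply: sumr_ge0. Qed.

Lemma negpowVK s n : (0 < n)%N -> negpow (- s) n * negpow s n = 1.
Proof. by move=> n0; rewrite negpowN // mulVf // gt_eqF // negpow_gt0. Qed.

(** With [d = gcdn a b] and [a = d * a'], the condition [lcmn a b <= V] reads
    [a' * b <= V] and no longer involves [d]. *)
Lemma sum_lcm_le p b V N : (0 < b)%N ->
  \sum_(1 <= a < N.+1 | (lcmn a b <= V)%N) negpow p a <= sigma p b * zeta_sum p (V %/ b).
Proof.
move=> b0.
pose G d a := if (a * b <= V)%N then negpow p (d * a) else 0.
apply: (@le_trans _ _ (\sum_(1 <= a < N.+1) G (gcdn a b) (a %/ gcdn a b)%N)).
  rewrite big_mkcond; apply: ler_sum => a _.
  by rewrite /G -lcm_divgcd mulnC divnK ?dvdn_gcdl.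
apply: le_trans (sum_gcd_split _ b0 _) _ => [d a|]; first by rewrite /G; case: ifP.
rewrite mulr_suml; apply: ler_sum => d _; rewrite -big_mkcond /=.
under eq_bigr do rewrite negpowM.
rewrite -mulr_sumr; apply: ler_wpM2l => //.
apply: (@ler_sum_inj _ _ _ _ _ _ _ id); rewrite ?iota_uniq // => a.
by rewrite !mem_index_iota !ltnS leq_divRL // => /andP[-> _].
Qed.

Lemma sum_lcm_gt p b V N : 0 < p -> (0 < b)%N -> (0 < V)%N ->
  \sum_(1 <= a < N.+1 | (V < lcmn a b)%N) negpow p a / (lcmn a b)%:R <=
  (1 + p^-1) * negpow p V * (negpow (1 - p) b * sigma p b).
Proof.
move=> p0 b0 V0.
pose G d a : R := if (V < a * b)%N then negpow p (d * a) / (a * b)%:R else 0.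
apply: (@le_trans _ _ (\sum_(1 <= a < N.+1) G (gcdn a b) (a %/ gcdn a b)%N)).
  rewrite big_mkcond; apply: ler_sum => a _.
  rewrite /G -lcm_divgcd (mulnC (gcdn a b)) divnK ?dvdn_gcdl //.
apply: le_trans (sum_gcd_split _ b0 _) _ => [d a|].
  by rewrite /G; case: ifP => // _; rewrite divr_ge0.
rewrite !mulr_sumr; apply: ler_sum => d _; rewrite -big_mkcond /=.
apply: (@le_trans _ _ (negpow p d * negpow 1 b *
   \sum_(1 <= a < N.+1 | (V < a * b)%N) negpow (1 + p) a)).
  rewrite mulr_sumr; apply: ler_sum_nat_cond => a /andP[a0 _] _.
  rewrite -negpow1 !negpowM negpowD // le_eqVlt; apply/predU1P; left; ring.
apply: le_trans (ler_wpM2l _ (zeta_sum_tail_div N p0 V0 b0)) _; first by rewrite mulr_ge0.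
by rewrite (negpowD 1 (- p) b0) le_eqVlt; apply/predU1P; left; ring.
Qed.

(** This is where the divisors of the shift are kept under control when the two
    exponents are equal. Let [e = gcdn k b] and [k = e * k']. The condition
    on [k] becomes [k' < b / g], so the sum over [k'] gains the factor
    [(e / g) ^ p] over what [k < b] alone would give. Hence the sum over the
    divisors [e] of [g] is [sigma p g], at most [sigma p b], whose mean over [b]
    is bounded. Without this gain it would be the number of divisors of [g],
    whose mean over [b] is the sum of the inverses of the divisors of the shift. *)
Lemma sum_codivisors p b g U : 0 < p -> p < 1 -> (0 < b)%N -> (g %| b)%N ->
  \sum_(1 <= k < U.+1 | (k * g < b * gcdn k b)%N && (gcdn k b %| g)%N)
     negpow (- p) k / (lcmn k b)%:R <= 2 / p * (negpow (1 - p) b * sigma p b).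
Proof.
move=> p0 p1 b0 gb; have g0 : (0 < g)%N := dvdn_gt0 b0 gb.
pose G e k : R := if (k * g < b)%N && (e %| g)%N
                  then negpow (- p) (e * k) / (k * b)%:R else 0.
apply: (@le_trans _ _ (\sum_(1 <= k < U.+1) G (gcdn k b) (k %/ gcdn k b)%N)).
  rewrite big_mkcond; apply: ler_sum => k _; rewrite /G -lcm_divgcd.
  have e0 : (0 < gcdn k b)%N by rewrite gcdn_gt0 b0 orbT.
  have E : (k %/ gcdn k b * g < b)%N = (k * g < b * gcdn k b)%N.
    by rewrite -[LHS](ltn_pmul2r e0) mulnAC divnK // dvdn_gcdl.
  by rewrite E (mulnC (gcdn k b)) divnK // dvdn_gcdl.
apply: le_trans (sum_gcd_split _ b0 _) _ => [d a|].
  by rewrite /G; case: ifP => // _; rewrite divr_ge0.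
have H e : (0 < e)%N -> (e %| g)%N -> \sum_(1 <= k < U.+1) G e k <=
    2 / p * negpow (1 - p) b * negpow p (g %/ e).
  move=> e0 eg; rewrite -big_mkcond /=.
  apply: (@le_trans _ _ (negpow (- p) e * negpow 1 b *
     \sum_(1 <= k < U.+1 | (k * g < b)%N && (e %| g)%N) negpow (1 - p) k)).
    rewrite mulr_sumr; apply: ler_sum_nat_cond => k /andP[k0 _] _.
    rewrite -negpow1 !negpowM negpowD // le_eqVlt; apply/predU1P; left; ring.
  apply: (@le_trans _ _ (negpow (- p) e * negpow 1 b * zeta_sum (1 - p) (b %/ g))).
    apply: ler_wpM2l; first by rewrite mulr_ge0.
    apply: (@ler_sum_inj _ _ _ _ _ _ _ id); rewrite ?iota_uniq // => k.
    rewrite !mem_index_iota !ltnS => /andP[-> _] /andP[kg _].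
    by rewrite leq_divRL // ltnW.
  have s0 : 0 <= 1 - p by lra.
  have s1 : 1 - p < 1 by lra.
  have := zeta_sum_lt1_div b s0 s1 g0.
  have -> : 1 - p - 1 = - p by ring.
  have -> : 1 - (1 - p) = p by ring.
  move=> h; apply: (@le_trans _ _ (negpow (- p) e * negpow 1 b *
     (2 / p * (negpow (- p) b * negpow p g)))).
    by apply: ler_wpM2l => //; rewrite mulr_ge0.
  rewrite (negpowD 1 (- p) b0).
  have -> : negpow p g = negpow p (g %/ e) * negpow p e by rewrite -negpowM divnK.
  rewrite le_eqVlt; apply/predU1P; left.
  rewrite -[RHS]mulr1 -(negpowVK p e0); ring.
apply: (@le_trans _ _ (\sum_(1 <= e < b.+1 | (e %| g)%N)
    2 / p * negpow (1 - p) b * negpow p (g %/ e))).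
  rewrite big_mkcond [leRHS]big_mkcond; apply: ler_sum_nat_cond => e /andP[e0 _] _.
  case: (boolP (e %| g)%N) => eg.
    by rewrite (dvdn_trans eg gb) H.
  case: ifP => // _; rewrite big1 // => k _; by rewrite /G (negbTE eg) andbF.
rewrite -mulr_sumr -mulrA !ler_wpM2l //; first by rewrite divr_ge0 ?ltW.
have gK e : (e %| g)%N -> (g %/ (g %/ e) = e)%N.
  move=> eg; rewrite -{1}(divnK eg) mulKn // divn_gt0 ?(dvdn_gt0 g0) //.
  exact: dvdn_leq.
apply: (@ler_sum_inj _ _ _ _ _ _ _ (fun e => g %/ e)%N); rewrite ?iota_uniq //.
  move=> e e'; rewrite !mem_filter => /andP[eg _] /andP[eg' _] E.
  by rewrite -(gK e) // E gK.
move=> e; rewrite !mem_index_iota !ltnS => /andP[e0 eb] eg.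
rewrite divn_gt0 // dvdn_leq //=; split=> //.
  by apply: leq_trans (leq_div _ _) _; exact: dvdn_leq.
by apply: dvdn_trans gb; apply/dvdnP; exists e; rewrite mulnC divnK.
Qed.

End Mixed.

#[local] Hint Extern 0 (is_true (@Order.le _ _ _ (sigma _ _))) =>
  exact: sigma_ge0 : core.

(** * One divisor beyond the square root *)

Section OneHigh.
Variable R : realType.
Implicit Types (s t p q x y : R) (N M d m n : nat).

Lemma hits_sum (S : pzSemiRingType) a b i j T :
  (hits a b i j T)%:R =
  \sum_(1 <= t < T.+1 | (a %| t + i)%N && (b %| t + j)%N) 1 :> S.
Proof. by rewrite natr_sum. Qed.

Lemma complementary_le (U n a : nat) :
  (n <= U * U)%N -> (U < a)%N -> (n %/ a <= U)%N.
Proof. by move=> nU Ua; rewrite -ltnS ltn_divLR; nia. Qed.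

Definition high U p n : R := if (U < n)%N then negpow p n else 0.

Lemma high_ge0 U p n : 0 <= high U p n.
Proof. by rewrite /high; case: ifP. Qed.

Lemma high_le_cst U p n : 0 <= p -> (0 < U)%N -> high U p n <= negpow p U.
Proof.
by move=> p0 U0; rewrite /high; case: ifP => // Un; rewrite negpow_anti // U0 ltnW.
Qed.

Lemma high_le_codiv U p n k : (0 < n)%N -> (k %| n)%N ->
  high U p (n %/ k) <= negpow (- p) k * negpow p n.
Proof.
move=> n0 kn; have k0 := dvdn_gt0 n0 kn.
apply: (@le_trans _ _ (negpow p (n %/ k))); first by rewrite /high; case: ifP.
rewrite -{2}(divnK kn) negpowM mulrCA negpowVK // mulr1 //.
Qed.

(** A pair with [lcmn a b > U * U] is hit at most once, but there are too many
    such pairs to count 1 for each. Instead, the sum is taken over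
    [k = (t + i) / a], which is at most [U], and for fixed [k] and [b] the [t]
    run over one residue class modulo [lcmn k b]. Moreover
    [lcmn a b > t + i = k * a] says that [k * gcdn a b < b], and
    [g = gcdn (k * a) b] divides [gcdn k b * gcdn a b]: together they give the
    condition on [k] of [sum_codivisors], in which [gcdn a b] has disappeared. *)
Lemma mixed_count p b U T i j : 0 < p -> p < 1 -> (0 < b)%N -> (0 < U)%N ->
  (T + i <= U * U)%N -> i = 0%N \/ j = 0%N ->
  \sum_(1 <= a < (U * U).+1 | (U < a)%N && (U * U < lcmn a b)%N)
     negpow p a * (hits a b i j T)%:R <=
  U%:R * negpow p U +
  zeta_sum p (U * U) * (2 / p * (negpow (1 - p) b * sigma p b)).
Proof.
move=> p0 p1 b0 U0 TU ij; set g := gcdn (i + j) b.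
pose Q k := (k * g < b * gcdn k b)%N && (gcdn k b %| g)%N.
under eq_bigr do rewrite hits_sum mulr_sumr.
rewrite (exchange_big_dep xpredT) //=.
apply: (@le_trans _ _ (\sum_(1 <= t < T.+1 | (b %| t + j)%N)
   \sum_(1 <= k < U.+1 | (k %| t + i)%N && Q k) high U p ((t + i) %/ k)%N)).
  rewrite [leRHS]big_mkcond; apply: ler_sum_nat_cond => t /andP[t0 tT] _.
  have n0 : (0 < t + i)%N by rewrite addn_gt0 t0.
  have nU : (t + i <= U * U)%N by lia.
  case: ifPn => bt; last first.
    by rewrite big1 // => a; rewrite !andbF.
  apply: le_trans (ler_sum_codvd (P := fun a => (U < a)%N && (U * U < lcmn a b)%N)
    n0 (high_ge0 U p) _).
    rewrite [leLHS]big_mkcond [leRHS]big_mkcond; apply: ler_sum => a _.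
    rewrite andbT mulr1 /high; case: (U < a)%N; rewrite /= ?andbF //.
    by rewrite andbC.
  move=> a _ an /andP[Ua La]; rewrite complementary_le //=.
  have a0 : (0 < a)%N by apply: leq_ltn_trans Ua.
  set k := ((t + i) %/ a)%N; have ka : (k * a = t + i)%N by rewrite divnK.
  have gE : g = gcdn (k * a) b by rewrite ka (gcdn_shift ij bt).
  rewrite /Q gE dvdn_gcd dvdn_gcdr andbT (dvdn_trans (dvdn_gcdl k b)) ?dvdn_mulr // andbT.
  have k0 : (0 < k)%N by rewrite divn_gt0 // dvdn_leq.
  have e0 : (0 < gcdn k b)%N by rewrite gcdn_gt0 k0.
  have d0 : (0 < gcdn a b)%N by rewrite gcdn_gt0 a0.
  (* This is lcm a b > k * a, multiplied out. *)
  have kd : (k * gcdn a b < b)%N.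
    rewrite -(ltn_pmul2l a0) mulnA (mulnC a k) ka -(muln_lcm_gcd a b) ltn_pmul2r //.
    exact: leq_ltn_trans nU La.
  apply: (@leq_ltn_trans (k * (gcdn k b * gcdn a b))).
    by rewrite leq_pmul2l // dvdn_leq ?muln_gt0 ?e0 // dvdn_gcd_mul.
  by rewrite mulnCA mulnC ltn_pmul2r.
rewrite (exchange_big_dep Q) /=; last by move=> t k _ /andP[].
apply: (@le_trans _ _ (\sum_(1 <= k < U.+1 | Q k)
  (negpow p U + negpow (- p) k * (lcmn k b)%:R^-1 * zeta_sum p (U * U)))).
  apply: ler_sum_nat_cond => k /andP[k0 _] Qk.
  apply: (@sum_gap _ _ _ _ i) => //; rewrite ?lcmn_gt0 ?k0 ?ltW //.
  - move=> m n /and3P[m1 m2 _] /and3P[n1 n2 _]; exact: (gap_lcm m2 m1 n2 n1).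
  - by move=> n _ _; apply: high_le_cst; rewrite ?ltW.
  - by move=> n /andP[n0 _] /and3P[_ kn _]; apply: high_le_codiv; rewrite ?addn_gt0 ?n0.
rewrite big_split /= lerD //.
  apply: (@le_trans _ _ (\sum_(1 <= k < U.+1) negpow p U)); first exact: ler_sum_sub.
  by rewrite sumr_const_nat subn1 /= mulr_natl.
rewrite -mulr_suml mulrC ler_wpM2l //.
exact: sum_codivisors (dvdn_gcdr _ _).
Qed.

(** For [s + p > 1] the first factor is bounded: on average over [b], [sigma p b]
    is bounded by a constant. *)
Lemma sum_sigma s p U : 0 < p ->
  \sum_(1 <= b < U.+1) negpow s b * sigma p b <= zeta_sum (s + p) U * zeta_sum s U.
Proof.
move=> p0; rewrite mulr_suml.
apply: (@le_trans _ _ (\sum_(1 <= b < U.+1) \sum_(1 <= d < U.+1 | (d %| b)%N)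
   negpow p d * negpow s b)).
  apply: ler_sum_nat_cond => b /andP[_ bU] _; rewrite mulrC mulr_suml.
  by apply: ler_sum_widen => // d; rewrite mulr_ge0.
rewrite (exchange_big_dep xpredT) //=.
apply: ler_sum_nat_cond => d /andP[d0 dU] _.
rewrite -mulr_sumr (addrC s) negpowD // -mulrA ler_wpM2l //.
apply: (@le_trans _ _ (\sum_(1 <= b < U.+1 | (d %| b)%N && true) negpow s b)).
  by apply: ler_sum_sub => // b _ ->.
apply: le_trans (ler_sum_dvd _ _ d0 _) _ => //.
under eq_bigr do rewrite negpowM.
rewrite -mulr_sumr ler_wpM2l //.
by apply: zeta_sum_le_widen; exact: leq_div.
Qed.

(** The range [b <= U < a]. Pairs with a small lcm are hit as often as expected,
    up to an error 1. For the others the hits and the expected number of hits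
    are bounded separately. *)
Lemma mixed_bound p q U T i j : 0 < p -> p < 1 -> 0 < q -> (0 < U)%N ->
  (T + i <= U * U)%N -> i = 0%N \/ j = 0%N ->
  \sum_(1 <= b < U.+1) \sum_(1 <= a < (U * U).+1 | (U < a)%N)
     negpow p a * negpow q b * `|(hits a b i j T)%:R - expected R a b i j T| <=
  U%:R * negpow p U * zeta_sum q U +
  (2 / (1 - p) + (1 + p^-1) + 2 / (1 - p) * (2 / p)) *
    negpow (p - 1) (U * U) * (zeta_sum (1 + q) U * zeta_sum (1 + q - p) U).
Proof.
move=> p0 p1 q0 U0 TU ij; set V := (U * U)%N.
have V0 : (0 < V)%N by rewrite muln_gt0 U0.
have TV : (T <= V)%N by apply: leq_trans TU; rewrite leq_addr.
have p1' : 0 < 1 - p by lra.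
set K := (_ + _ + _); have K0 : 0 <= K.
  by rewrite !addr_ge0 ?mulr_ge0 ?invr_ge0 ?ltW.
apply: (@le_trans _ _ (\sum_(1 <= b < U.+1) (negpow q b * (U%:R * negpow p U) +
   K * negpow (p - 1) V * (negpow (1 + q - p) b * sigma p b)))); last first.
  rewrite big_split /= -mulr_suml -mulr_sumr mulrC lerD2l ler_wpM2l ?mulr_ge0 //.
  have -> : zeta_sum (1 + q) U = zeta_sum (1 + q - p + p) U by rewrite subrK.
  exact: sum_sigma.
apply: ler_sum_nat_cond => b /andP[b0 bU] _.
have -> : 1 + q - p = q + (1 - p) by ring.
rewrite (negpowD q (1 - p) b0).
have -> : K * negpow (p - 1) V * (negpow q b * negpow (1 - p) b * sigma p b) =
  negpow q b * (K * negpow (p - 1) V * (negpow (1 - p) b * sigma p b)) by ring.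
rewrite -mulrDr; set S := negpow (1 - p) b * _.
under eq_bigr do rewrite (mulrC (negpow p _)) -mulrA.
rewrite -mulr_sumr ler_wpM2l //.
apply: (@le_trans _ _ (
   \sum_(1 <= a < V.+1 | (lcmn a b <= V)%N) negpow p a +
   V%:R * \sum_(1 <= a < V.+1 | (V < lcmn a b)%N) negpow p a / (lcmn a b)%:R +
   \sum_(1 <= a < V.+1 | (U < a)%N && (V < lcmn a b)%N)
      negpow p a * (hits a b i j T)%:R)).
  rewrite mulr_sumr [in leLHS]big_mkcond [X in _ <= X + _ + _]big_mkcond
    [X in _ <= _ + X + _]big_mkcond [X in _ <= _ + X]big_mkcond -!big_split /=.
  apply: ler_sum_nat_cond => a /andP[a0 _] _.
  case: (leqP (lcmn a b) V) => Lab.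
    rewrite andbF !addr0; case: ifP => // _.
    by rewrite -[leRHS]mulr1 ler_wpM2l // hits_approx.
  rewrite andbT add0r; case: ifP => _; last by rewrite addr0 mulr_ge0 ?divr_ge0.
  rewrite addrC mulrCA -mulrDr ler_wpM2l //.
  apply: le_trans (ler_normB _ _) _.
  rewrite (ger0_norm (expected_ge0 _ _ _ _ _ _)) normr_nat lerD2l /expected.
  case: ifP => _; last by rewrite divr_ge0.
  by rewrite ler_wpM2r ?invr_ge0 // ler_nat.
have z1 := zeta_sum_lt1_div V (ltW p0) p1 b0.
have z2 : zeta_sum p V <= 2 / (1 - p) * negpow (p - 1) V by apply: zeta_sum_lt1; rewrite ?ltW.
have S0 : 0 <= S by rewrite mulr_ge0.
have h1 : \sum_(1 <= a < V.+1 | (lcmn a b <= V)%N) negpow p a <=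
   2 / (1 - p) * negpow (p - 1) V * S.
  apply: le_trans (sum_lcm_le _ _ _ b0) _.
  apply: le_trans (ler_wpM2l _ z1) _ => //.
  by rewrite le_eqVlt; apply/predU1P; left; rewrite /S; ring.
have h2 : V%:R * \sum_(1 <= a < V.+1 | (V < lcmn a b)%N) negpow p a / (lcmn a b)%:R <=
   (1 + p^-1) * negpow (p - 1) V * S.
  apply: le_trans (ler_wpM2l _ (sum_lcm_gt _ p0 b0 V0)) _ => //.
  rewrite -/S -negpowN1 (negpowD p (-1) V0) le_eqVlt; apply/predU1P; left; ring.
have h3 := mixed_count p0 p1 b0 U0 TU ij; rewrite -/V -/S in h3.
have h4 : zeta_sum p V * (2 / p * S) <= 2 / (1 - p) * (2 / p) * negpow (p - 1) V * S.
  apply: le_trans (ler_wpM2r _ z2) _; first by rewrite mulr_ge0 // divr_ge0 ?ltW.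
  by rewrite le_eqVlt; apply/predU1P; left; ring.
apply: le_trans (lerD (lerD h1 h2) (le_trans h3 (lerD (lexx _) h4))) _.
by rewrite le_eqVlt; apply/predU1P; left; rewrite /K; ring.
Qed.

End OneHigh.

#[local] Hint Extern 0 (is_true (@Order.le _ _ _ (high _ _ _))) =>
  exact: high_ge0 : core.

(** * Both divisors beyond the square root *)

Section BothHigh.
Variable R : realType.
Implicit Types (s t p q r x y : R) (N M d m n : nat).

Lemma inv_lcm a b : (0 < a)%N -> (0 < b)%N ->
  (lcmn a b)%:R^-1 = (gcdn a b)%:R * (negpow 1 a * negpow 1 b) :> R.
Proof.
move=> a0 b0; rewrite -negpowM negpow1 -muln_lcm_gcd natrM invfM mulrCA divff ?mulr1 //.
by rewrite pnatr_eq0 -lt0n gcdn_gt0 a0.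
Qed.

Lemma sum_gcd_low p q U : 0 < p -> p <= 1 -> 0 < q -> q <= 1 ->
  \sum_(1 <= k < U.+1) \sum_(1 <= l < U.+1)
     (gcdn k l)%:R * (negpow (1 - p) k * negpow (1 - q) l) <=
  4 / (p * q) * negpow (- (p + q)) U * zeta_sum 1 U.
Proof.
move=> p0 p1 q0 q1; apply: le_trans (sum_gcd_mul _ _ _) _ => //.
rewrite /zeta_sum mulr_sumr; apply: ler_sum_nat_cond => d /andP[d0 dU] _.
have U0 : (0 < U)%N by apply: leq_trans dU.
have H r : 0 < r -> r <= 1 -> \sum_(1 <= a < (U %/ d).+1) negpow (1 - r) (d * a) <=
    2 / r * negpow (- r) U * negpow 1 d.
  move=> r0 r1; under eq_bigr do rewrite negpowM.
  rewrite -mulr_sumr -/(zeta_sum (1 - r) (U %/ d)).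
  have s0 : 0 <= 1 - r by lra.
  have s1 : 1 - r < 1 by lra.
  have := zeta_sum_lt1_div U s0 s1 d0.
  have -> : 1 - r - 1 = - r by ring.
  have -> : 1 - (1 - r) = r by ring.
  move=> h; apply: le_trans (ler_wpM2l _ h) _ => //.
  have -> : negpow 1 d = negpow (1 - r) d * negpow r d by rewrite -negpowD // subrK.
  by rewrite le_eqVlt; apply/predU1P; left; ring.
apply: (@le_trans _ _ (d%:R * ((2 / p * negpow (- p) U * negpow 1 d) *
                               (2 / q * negpow (- q) U * negpow 1 d)))).
  by rewrite ler_wpM2l // ler_pM ?sumr_ge0 // ; exact: H.
rewrite opprD (negpowD (- p) (- q) U0) invfM.
have dK : d%:R * negpow 1 d = 1 :> R by rewrite negpow1 divff // pnatr_eq0 -lt0n.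
rewrite le_eqVlt; apply/predU1P; left.
rewrite -[RHS]mulr1 -[X in _ = _ * X]dK; ring.
Qed.

Lemma natr_negpow U : (U%:R : R) = negpow (-1) U.
Proof. by rewrite negpowN1. Qed.

Lemma sum_mul_common (S : comPzSemiRingType) V T (P Q : nat -> nat -> bool) (u v : nat -> S) :
  \sum_(1 <= a < V.+1) \sum_(1 <= b < V.+1) u a * v b *
     \sum_(1 <= t < T.+1 | P a t && Q b t) 1 =
  \sum_(1 <= t < T.+1) (\sum_(1 <= a < V.+1 | P a t) u a) *
                       (\sum_(1 <= b < V.+1 | Q b t) v b).
Proof.
under eq_bigr => a _ do under eq_bigr => b _ do rewrite mulr_sumr big_mkcond /=.
under eq_bigr do rewrite exchange_big /=.
rewrite exchange_big /=; apply: eq_bigr => t _.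
rewrite big_distrlr /= [RHS]big_mkcond; apply: eq_bigr => a _.
case: (P a t) => /=; last by rewrite big1.
by rewrite [RHS]big_mkcond; apply: eq_bigr => b _; rewrite mulr1.
Qed.

(** Both divisors are replaced by their complements [k, l <= U], and [t] runs
    over a residue class modulo [lcmn k l]. Lowering the exponent [q] to [r] on
    the way makes the total exponent [p + r] of [t] less than 1, as
    [zeta_sum_lt1] requires. The remaining sums are those of [k ^ (p - 1)] and
    [l ^ (r - 1)], with exponents above -1, so that only the sum over the
    common divisors of [k] and [l] yields a logarithm. *)
Lemma both_large_count p q r U T i j : 0 < p -> 0 < r -> r <= q -> p + r < 1 ->
  (0 < U)%N -> (T + i <= U * U)%N -> (T + j <= U * U)%N ->
  \sum_(1 <= a < (U * U).+1) \sum_(1 <= b < (U * U).+1)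
     high U p a * high U q b * (hits a b i j T)%:R <=
  (1 + 8 / (p * r * (1 - p - r))) * negpow (p + q - 2) U * zeta_sum 1 U.
Proof.
move=> p0 r0 rq pr1 U0 Ti Tj; set V := (U * U)%N.
have q0 : 0 < q by lra.
under eq_bigr => a _ do under eq_bigr => b _ do rewrite hits_sum.
rewrite sum_mul_common.
have codiv n s : (0 < n)%N -> (n <= V)%N ->
    \sum_(1 <= a < V.+1 | (a %| n)%N) high U s a <=
    \sum_(1 <= k < U.+1 | (k %| n)%N) high U s (n %/ k)%N.
  move=> n0 nV.
  apply: le_trans (_ : \sum_(1 <= a < V.+1 | (a %| n)%N && (U < a)%N) high U s a <= _).
    rewrite big_mkcond [leRHS]big_mkcond; apply: ler_sum => a _; rewrite /high.
    by case: ifP => // _; case: ifP.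
  apply: le_trans (ler_sum_codvd (M := U) (Q := xpredT) n0 (high_ge0 U s) _) _.
    by move=> a _ an Ua; rewrite complementary_le.
  by apply: ler_sum_sub => // k _; rewrite andbT.
apply: (@le_trans _ _ (\sum_(1 <= t < T.+1)
   (\sum_(1 <= k < U.+1 | (k %| t + i)%N) high U p ((t + i) %/ k)%N) *
   (\sum_(1 <= l < U.+1 | (l %| t + j)%N) high U q ((t + j) %/ l)%N))).
  apply: ler_sum_nat_cond => t /andP[t0 tT] _.
  by rewrite ler_pM ?sumr_ge0 // codiv ?addn_gt0 ?t0 //; lia.
apply: (@le_trans _ _ (\sum_(1 <= k < U.+1) \sum_(1 <= l < U.+1)
   \sum_(1 <= t < T.+1 | (k %| t + i)%N && (l %| t + j)%N)
      high U p ((t + i) %/ k)%N * high U q ((t + j) %/ l)%N)).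
  rewrite le_eqVlt; apply/predU1P; left.
  under [RHS]eq_bigr do rewrite (exchange_big_dep xpredT) //=.
  rewrite [RHS](exchange_big_dep xpredT) //=; apply: eq_bigr => t _.
  rewrite big_distrlr /= big_mkcond; apply: eq_bigr => k _.
  by case: ifP => kt /=; rewrite ?big_pred0_eq.
apply: (@le_trans _ _ (\sum_(1 <= k < U.+1) \sum_(1 <= l < U.+1)
   (negpow p U * negpow q U +
    negpow (q - r) U * zeta_sum (p + r) V *
      ((gcdn k l)%:R * (negpow (1 - p) k * negpow (1 - r) l))))).
  apply: ler_sum_nat_cond => k /andP[k0 kU] _.
  apply: ler_sum_nat_cond => l /andP[l0 lU] _.
  have -> : negpow (q - r) U * zeta_sum (p + r) V *
      ((gcdn k l)%:R * (negpow (1 - p) k * negpow (1 - r) l)) =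
     (negpow (- p) k * negpow (- r) l * negpow (q - r) U) * (lcmn k l)%:R^-1 * zeta_sum (p + r) V.
    by rewrite inv_lcm // (negpowD 1 (- p) k0) (negpowD 1 (- r) l0); ring.
  have TV0 : (T + 0 <= V)%N by rewrite addn0; lia.
  apply: (sum_gap _ _ _ _ TV0); rewrite ?lcmn_gt0 ?k0 ?mulr_ge0 // ?addr_ge0 ?ltW //.
  - move=> m n /andP[m1 m2] /andP[n1 n2]; exact: (gap_lcm m1 m2 n1 n2).
  - by move=> n _ _; rewrite ler_pM // high_le_cst ?ltW.
  move=> n /andP[n0 nT] /andP[kn ln]; rewrite addn0.
  have ni0 : (0 < n + i)%N by rewrite addn_gt0 n0.
  have nj0 : (0 < n + j)%N by rewrite addn_gt0 n0.
  have -> : negpow (- p) k * negpow (- r) l * negpow (q - r) U * negpow (p + r) n =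
    (negpow (- p) k * negpow p n) * (negpow (q - r) U * (negpow (- r) l * negpow r n)).
    by rewrite (negpowD p r n0); ring.
  apply: ler_pM => //.
    apply: le_trans (high_le_codiv _ _ ni0 kn) _.
    by rewrite ler_wpM2l // negpow_anti ?ltW // n0 leq_addr.
  apply: (@le_trans _ _ (negpow (q - r) U * high U r ((n + j) %/ l)%N)).
    rewrite /high; case: ifP => [Un|_]; last by rewrite mulr0.
    have Un0 : (0 < (n + j) %/ l)%N by apply: leq_ltn_trans Un.
    have -> : negpow q ((n + j) %/ l) =
       negpow (q - r) ((n + j) %/ l) * negpow r ((n + j) %/ l).
      by rewrite -negpowD // subrK.
    by rewrite ler_wpM2r // negpow_anti ?subr_ge0 // U0 ltnW.
  rewrite ler_wpM2l //; apply: le_trans (high_le_codiv _ _ nj0 ln) _.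
  by rewrite ler_wpM2l // negpow_anti ?ltW // n0 leq_addr.
under eq_bigr do rewrite big_split /= -mulr_sumr.
rewrite big_split /= -mulr_sumr.
rewrite !sumr_const_nat subn1 /= -mulrnA -[_ *+ _]mulr_natl natrM natr_negpow.
have -> : p + q - 2 = (-1) + (-1) + p + q by ring.
have z := sum_gcd_low U p0 _ r0 _.
have zz : zeta_sum (p + r) V <= 2 / (1 - p - r) * negpow (p + r - 1) V.
  by rewrite -(addrA 1) -opprD; apply: zeta_sum_lt1; lra.
have V0 : (0 < V)%N by rewrite muln_gt0 U0.
rewrite 2!mulrDl mul1r lerD //.
  set E := negpow (_ + q) U; apply: (@le_trans _ _ (E * 1)); last first.
    by rewrite ler_wpM2l ?negpow_ge0 ?zeta_sum_ge1.
  rewrite /E !(negpowD _ _ U0) le_eqVlt; apply/predU1P; left; ring.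
under eq_bigr do rewrite -mulr_sumr.
rewrite -mulr_sumr.
apply: (@le_trans _ _ (negpow (q - r) U *
  (2 / (1 - p - r) * negpow (p + r - 1) V) * (4 / (p * r) * negpow (- (p + r)) U * zeta_sum 1 U))).
  apply: ler_pM => //.
  - by rewrite mulr_ge0.
  - by apply: sumr_ge0 => k _; apply: sumr_ge0 => l _; rewrite !mulr_ge0.
  - by rewrite ler_wpM2l.
  - by apply: z; lra.
have -> : negpow (-1 + -1 + p + q) U =
   negpow (q - r) U * negpow (p + r - 1) V * negpow (- (p + r)) U.
  rewrite /V negpowM -!negpowD //; congr (negpow _ U); ring.
rewrite le_eqVlt; apply/predU1P; left; field.
by rewrite !gt_eqF //; lra.
Qed.

(** Common divisors [d <= U] contribute the sum of [1 / d]; beyond [U] the sums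
    over the cofactors are just bounded and [d ^ (-1 - p - q)] is summed. *)
Lemma both_large_expected p q U T i j : 0 < p -> 0 < q ->
  (0 < U)%N -> (T <= U * U)%N ->
  \sum_(1 <= a < (U * U).+1) \sum_(1 <= b < (U * U).+1)
     high U p a * high U q b * expected R a b i j T <=
  (1 + p^-1) * (1 + q^-1) * (1 + (p + q)^-1) * negpow (p + q - 2) U * zeta_sum 1 U.
Proof.
move=> p0 q0 U0 TV; set V := (U * U)%N.
have V0 : (0 < V)%N by rewrite muln_gt0 U0.
apply: (@le_trans _ _ (T%:R * \sum_(1 <= a < V.+1) \sum_(1 <= b < V.+1)
   (gcdn a b)%:R * (high U (1 + p) a * high U (1 + q) b))).
  rewrite mulr_sumr; apply: ler_sum_nat_cond => a /andP[a0 _] _.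
  rewrite mulr_sumr; apply: ler_sum_nat_cond => b /andP[b0 _] _.
  rewrite /high; case: ifP => _; last by rewrite !mul0r !mulr0.
  case: ifP => _; last by rewrite mulr0 !mul0r !mulr0.
  rewrite /expected; case: ifP => _; last by rewrite mulr0 !mulr_ge0.
  rewrite inv_lcm // !negpowD // le_eqVlt; apply/predU1P; left; ring.
apply: (@le_trans _ _ (negpow (-2) U * ((1 + p^-1) * (1 + q^-1) * (1 + (p + q)^-1) *
   (negpow (p + q) U * zeta_sum 1 U)))); last first.
  have -> : p + q - 2 = -2 + (p + q) by ring.
  by rewrite (negpowD (-2)) // le_eqVlt; apply/predU1P; left; ring.
have C0 : 0 <= (1 + p^-1) * (1 + q^-1) by rewrite mulr_ge0 // addr_ge0 ?invr_ge0 ?ltW.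
apply: ler_pM => //.
  by apply: sumr_ge0 => a _; apply: sumr_ge0 => b _; rewrite !mulr_ge0.
  have -> : -2 = -1 + -1 :> R by ring.
  by rewrite negpowD // -natr_negpow -natrM ler_nat.
apply: le_trans (sum_gcd_mul _ _ _) _ => //.
rewrite (bigID (fun d => U < d)%N) /= addrC.
have H s d : 0 < s -> (0 < d)%N -> \sum_(1 <= a < (V %/ d).+1) high U (1 + s) (d * a) <=
    negpow (1 + s) d * \sum_(1 <= a < V.+1 | (U < a * d)%N) negpow (1 + s) a.
  move=> s0 d0; rewrite /high -big_mkcond /= mulr_sumr.
  under eq_bigr do rewrite negpowM.
  under eq_bigl do rewrite mulnC.
  apply: ler_sum_widen => [|n]; [exact: leq_div | by rewrite mulr_ge0].
have dK d : (0 < d)%N -> d%:R * negpow 1 d = 1 :> R.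
  by move=> d0; rewrite negpow1 divff // pnatr_eq0 -lt0n.
have -> : (1 + p^-1) * (1 + q^-1) * (1 + (p + q)^-1) * (negpow (p + q) U * zeta_sum 1 U) =
   (1 + p^-1) * (1 + q^-1) * (negpow (p + q) U * zeta_sum 1 U) +
   (1 + p^-1) * (1 + q^-1) * ((p + q)^-1 * (negpow (p + q) U * zeta_sum 1 U)) by ring.
apply: lerD.
  apply: (@le_trans _ _ (\sum_(1 <= d < V.+1 | ~~ (U < d)%N)
     (1 + p^-1) * (1 + q^-1) * (negpow (p + q) U * negpow 1 d))).
    apply: ler_sum_nat_cond => d /andP[d0 _] dU.
    apply: (@le_trans _ _ (d%:R *
     ((negpow (1 + p) d * ((1 + p^-1) * (negpow p U * negpow (- p) d))) *
      (negpow (1 + q) d * ((1 + q^-1) * (negpow q U * negpow (- q) d)))))).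
      rewrite ler_wpM2l // ler_pM ?sumr_ge0 //; apply: le_trans (H _ _ _ d0) _ => //;
        rewrite ler_wpM2l //; exact: zeta_sum_tail_div.
    rewrite !(negpowD 1) // (negpowD p) //.
    rewrite le_eqVlt; apply/predU1P; left.
    rewrite -[RHS]mulr1 -[X in _ = _ * X](dK d d0).
    rewrite -[RHS]mulr1 -[X in _ = _ * X](negpowVK p d0).
    rewrite -[RHS]mulr1 -[X in _ = _ * X](negpowVK q d0).
    ring.
  rewrite -!mulr_sumr ler_wpM2l // ler_wpM2l //.
  apply: (@ler_sum_inj _ _ _ _ _ _ _ id); rewrite ?iota_uniq // => d.
  by rewrite !mem_index_iota !ltnS -leqNgt => /andP[-> _] ->.
apply: (@le_trans _ _ (\sum_(1 <= d < V.+1 | (U < d)%N)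
   (1 + p^-1) * (1 + q^-1) * negpow (1 + (p + q)) d)).
  apply: ler_sum_nat_cond => d /andP[d0 _] dU.
  have z s : 0 < s -> \sum_(1 <= a < V.+1 | (U < a * d)%N) negpow (1 + s) a <= 1 + s^-1.
    move=> s0; apply: le_trans (zeta_sum_gt1 V s0).
    by apply: ler_sum_sub.
  apply: (@le_trans _ _ (d%:R * ((negpow (1 + p) d * (1 + p^-1)) *
      (negpow (1 + q) d * (1 + q^-1))))).
    rewrite ler_wpM2l // ler_pM ?sumr_ge0 //; apply: le_trans (H _ _ _ d0) _ => //;
      by rewrite ler_wpM2l // z.
  rewrite !(negpowD 1) // (negpowD p) //.
  by rewrite le_eqVlt; apply/predU1P; left; rewrite -[RHS]mulr1 -[X in _ = _ * X](dK d d0); ring.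
rewrite -mulr_sumr ler_wpM2l //.
have pq0 : 0 < p + q by rewrite addr_gt0.
apply: le_trans (zeta_sum_tail _ pq0 U0) _.
apply: ler_wpM2l; first by rewrite invr_ge0 ltW.
by rewrite ler_peMr // zeta_sum_ge1.
Qed.

End BothHigh.

(** * The total deviation and the tail of the series *)

Section Assembly.
Variable R : realType.
Implicit Types (s t p q r x y alpha beta : R) (N M d m n U V : nat).

Definition dev (a b i j T : nat) : R :=
  `|(hits a b i j T)%:R - expected R a b i j T|.

Lemma dev_ge0 a b i j T : 0 <= dev a b i j T.
Proof. exact: normr_ge0. Qed.

Lemma devC a b i j T : dev a b i j T = dev b a j i T.
Proof.
rewrite /dev /expected gcdnC addnC lcmnC; congr (`|_%:R - _|).
by apply: eq_bigl => t; rewrite andbC.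
Qed.

Lemma dev_le a b i j T :
  dev a b i j T <= (hits a b i j T)%:R + expected R a b i j T.
Proof.
apply: le_trans (ler_normB _ _) _.
by rewrite normr_nat (ger0_norm (expected_ge0 _ _ _ _ _ _)).
Qed.

(** For [s = 1] and [p > 0] this absorbs a logarithm into the power of [U],
    and nothing is lost for [p = 0]. *)
Lemma negpow_zeta_sum s p U : 0 <= p -> negpow p U * zeta_sum s U <= zeta_sum (p + s) U.
Proof.
move=> p0; rewrite mulr_sumr; apply: ler_sum_nat_cond => u /andP[u0 uU] _.
by rewrite negpowD // ler_wpM2r // negpow_anti // u0.
Qed.

Lemma sum_low U V (F : nat -> R) : (forall n, 0 <= F n) ->
  \sum_(1 <= a < V.+1 | ~~ (U < a)%N) F a <= \sum_(1 <= a < U.+1) F a.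
Proof.
move=> F0; apply: (@ler_sum_inj _ _ _ _ _ _ _ id); rewrite ?iota_uniq // => d.
by rewrite !mem_index_iota !ltnS -leqNgt => /andP[-> _] ->.
Qed.

Lemma dev_box alpha beta V i j T : i = 0%N \/ j = 0%N ->
  \sum_(1 <= a < V.+1) \sum_(1 <= b < V.+1)
     negpow alpha a * negpow beta b * dev a b i j T <= zeta_sum alpha V * zeta_sum beta V.
Proof.
move=> ij; rewrite big_distrlr /=.
apply: ler_sum_nat_cond => a /andP[a0 _] _; apply: ler_sum_nat_cond => b /andP[b0 _] _.
by rewrite -[leRHS]mulr1 ler_wpM2l ?mulr_ge0 // hits_approx.
Qed.

Definition mixed_const p q : R :=
  2 / (1 - q) + (2 / (1 - p) + (1 + p^-1) + 2 / (1 - p) * (2 / p)) * (1 + q^-1).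

Lemma mixed_const_ge0 p q : 0 < p -> p < 1 -> 0 < q -> q < 1 -> 0 <= mixed_const p q.
Proof.
move=> p0 p1 q0 q1; have p1' : 0 < 1 - p by lra.
have q1' : 0 < 1 - q by lra.
by rewrite /mixed_const !(addr_ge0, mulr_ge0) ?invr_ge0 ?ltW.
Qed.

Lemma mixed_dev p q U T i j : 0 < p -> p < 1 -> 0 < q -> q < 1 -> (0 < U)%N ->
  (T + i <= U * U)%N -> i = 0%N \/ j = 0%N ->
  \sum_(1 <= b < U.+1) \sum_(1 <= a < (U * U).+1 | (U < a)%N)
     negpow p a * negpow q b * dev a b i j T <=
  mixed_const p q * (negpow (p + q - 2) U + negpow (2 * p - 2) U * zeta_sum (1 + q - p) U).
Proof.
move=> p0 p1 q0 q1 U0 Ti ij; apply: le_trans (mixed_bound p0 p1 q0 U0 Ti ij) _.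
have p1' : 0 < 1 - p by lra.
have q1' : 0 < 1 - q by lra.
set K := (_ + _ + _); have K0 : 0 <= K.
  by rewrite !addr_ge0 ?mulr_ge0 ?invr_ge0 ?ltW.
have Q0 : 0 <= 1 + q^-1 by rewrite addr_ge0 // invr_ge0 ltW.
have Q2 : 0 <= 2 / (1 - q) by rewrite divr_ge0 // ltW.
rewrite /mixed_const -/K.
set X := negpow (p + q - 2) U; set Y := negpow (2 * p - 2) U * _.
have X0 : 0 <= X by exact: negpow_ge0.
have Y0 : 0 <= Y by rewrite mulr_ge0.
have h1 : U%:R * negpow p U * zeta_sum q U <= 2 / (1 - q) * X.
  apply: le_trans (ler_wpM2l _ (zeta_sum_lt1 U (ltW q0) q1)) _; first by rewrite mulr_ge0.
  have -> : X = negpow (-1) U * negpow p U * negpow (q - 1) U.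
    by rewrite -!negpowD //; congr (negpow _ U); ring.
  by rewrite natr_negpow le_eqVlt; apply/predU1P; left; ring.
have h2 : K * negpow (p - 1) (U * U) * (zeta_sum (1 + q) U * zeta_sum (1 + q - p) U) <=
    K * (1 + q^-1) * Y.
  apply: (@le_trans _ _ (K * negpow (p - 1) (U * U) * ((1 + q^-1) * zeta_sum (1 + q - p) U))).
    by rewrite ler_wpM2l ?mulr_ge0 // ler_wpM2r // zeta_sum_gt1.
  have -> : Y = negpow (p - 1) U * negpow (p - 1) U * zeta_sum (1 + q - p) U.
    by rewrite -negpowD //; congr (negpow _ U * _); ring.
  by rewrite negpowM le_eqVlt; apply/predU1P; left; ring.
apply: le_trans (lerD h1 h2) _.
set A := 2 / (1 - q); set B := K * _.
have B0 : 0 <= B by rewrite mulr_ge0.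
have -> : (A + B) * (X + Y) = (A * X + B * Y) + (A * Y + B * X) by ring.
by rewrite lerDl addr_ge0 // mulr_ge0.
Qed.

(** The box is cut at [U] in both directions. The last factor is
    bounded if [alpha < beta] and is logarithmic if [alpha = beta], which is
    the distinction made by the error function. *)
Lemma dev_bound alpha beta : 0 < alpha -> alpha <= beta -> beta < 1 ->
  exists2 K : R, 0 <= K & forall U T i j, (0 < U)%N ->
    (T + i <= U * U)%N -> (T + j <= U * U)%N -> i = 0%N \/ j = 0%N ->
    \sum_(1 <= a < (U * U).+1) \sum_(1 <= b < (U * U).+1)
       negpow alpha a * negpow beta b * dev a b i j T <=
    K * (negpow (2 * alpha - 2) U * zeta_sum (1 + beta - alpha) U).
Proof.
move=> a0 ab b1; have b0 : 0 < beta by lra.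
have a1 : alpha < 1 by lra.
(* This r satisfies r <= alpha <= beta and alpha + r = 1 - (1 - alpha) ^ 2 < 1. *)
pose r := alpha * (1 - alpha).
have r0 : 0 < r by rewrite mulr_gt0 //; lra.
have rb : r <= beta by apply: le_trans ab; rewrite /r; nra.
have ar : alpha + r < 1 by rewrite /r; nra.
pose K1 := 4 / ((1 - alpha) * (1 - beta)).
pose K3 := 1 + 8 / (alpha * r * (1 - alpha - r)).
pose K4 := (1 + alpha^-1) * (1 + beta^-1) * (1 + (alpha + beta)^-1).
pose K2 := K3 + K4.
have K10 : 0 <= K1 by rewrite divr_ge0 ?mulr_ge0 //; lra.
have K20 : 0 <= K2.
  rewrite /K2 /K3 /K4; apply: addr_ge0; last by rewrite !(addr_ge0, mulr_ge0) ?invr_ge0 ?ltW // addr_gt0.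
  by rewrite addr_ge0 // divr_ge0 // !mulr_ge0 ?ltW //; lra.
have M1 := mixed_const_ge0 a0 a1 b0 b1; have M2 := mixed_const_ge0 b0 b1 a0 a1.
exists (K1 + 2 * mixed_const alpha beta + 2 * mixed_const beta alpha + K2).
  by do 3?[apply: addr_ge0 => //]; exact: mulr_ge0.
move=> U T i j U0 Ti Tj ij; set V := (U * U)%N; set E := _ * zeta_sum _ _.
have E1 : negpow (2 * alpha - 2) U <= E by rewrite /E ler_peMr // zeta_sum_ge1.
have E2 : negpow (alpha + beta - 2) U <= E.
  by apply: le_trans E1; apply: negpow_le => //; lra.
have E3 : negpow (alpha + beta - 2) U * zeta_sum 1 U <= E.
  have -> : alpha + beta - 2 = 2 * alpha - 2 + (beta - alpha) by ring.
  rewrite negpowD // -mulrA ler_wpM2l //.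
  apply: le_trans (negpow_zeta_sum _ _ _) _; first by lra.
  by rewrite addrC addrA.
have E4 : negpow (2 * beta - 2) U * zeta_sum (1 + alpha - beta) U <= E.
  have -> : 2 * beta - 2 = 2 * alpha - 2 + 2 * (beta - alpha) by ring.
  rewrite negpowD // -mulrA ler_wpM2l //.
  apply: le_trans (negpow_zeta_sum _ _ _) _; first by lra.
  by rewrite le_eqVlt; apply/predU1P; left; congr (zeta_sum _ U); ring.
pose X a b := negpow alpha a * negpow beta b * dev a b i j T.
have X0 a b : 0 <= X a b by rewrite !mulr_ge0 // dev_ge0.
have LL : \sum_(1 <= a < U.+1) \sum_(1 <= b < U.+1) X a b <= K1 * E.
  apply: le_trans (dev_box _ _ _ _ ij) _.
  apply: le_trans (_ : K1 * negpow (alpha + beta - 2) U <= _); last exact: ler_wpM2l.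
  have -> : alpha + beta - 2 = (alpha - 1) + (beta - 1) by ring.
  rewrite negpowD //.
  apply: le_trans (ler_pM _ _ (zeta_sum_lt1 U (ltW a0) a1) (zeta_sum_lt1 U (ltW b0) b1)) _ => //.
  by rewrite le_eqVlt /K1 invfM; apply/predU1P; left; ring.
have RL : \sum_(1 <= b < U.+1) \sum_(1 <= a < V.+1 | (U < a)%N) X a b <=
    2 * mixed_const alpha beta * E.
  apply: le_trans (mixed_dev a0 a1 b0 b1 U0 Ti ij) _.
  rewrite -[leRHS]mulrA [leRHS]mulrCA; apply: ler_wpM2l => //.
  by rewrite [2 * E]mulr_natl mulr2n lerD.
have LR : \sum_(1 <= a < U.+1) \sum_(1 <= b < V.+1 | (U < b)%N) X a b <=
    2 * mixed_const beta alpha * E.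
  have ji : j = 0%N \/ i = 0%N by case: ij; [right | left].
  apply: le_trans (_ : mixed_const beta alpha * (negpow (beta + alpha - 2) U +
     negpow (2 * beta - 2) U * zeta_sum (1 + alpha - beta) U) <= _).
    apply: le_trans (mixed_dev b0 b1 a0 a1 U0 Tj ji).
    apply: ler_sum => a _; apply: ler_sum => b _.
    by rewrite /X devC (mulrC (negpow alpha _)).
  rewrite -[leRHS]mulrA [leRHS]mulrCA; apply: ler_wpM2l => //.
  by rewrite [2 * E]mulr_natl mulr2n (addrC beta) lerD.
have RR : \sum_(1 <= a < V.+1 | (U < a)%N) \sum_(1 <= b < V.+1 | (U < b)%N) X a b <= K2 * E.
  apply: le_trans (_ : K2 * (negpow (alpha + beta - 2) U * zeta_sum 1 U) <= _);
    last exact: ler_wpM2l.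
  have TV : (T <= U * U)%N by apply: leq_trans Ti; rewrite leq_addr.
  rewrite [leRHS]mulrDl [in leRHS]mulrA [X in _ <= _ + X]mulrA.
  apply: le_trans (lerD (both_large_count a0 r0 rb ar U0 Ti Tj)
                        (both_large_expected i j a0 b0 U0 TV)).
  rewrite -big_split /= big_mkcond; apply: ler_sum => a _; rewrite -big_split /=.
  case: ifP => Ua; last first.
    by apply: sumr_ge0 => b _; rewrite -mulrDr mulr_ge0 ?mulr_ge0 ?addr_ge0 ?expected_ge0.
  rewrite big_mkcond; apply: ler_sum => b _; rewrite -mulrDr /high Ua.
  by case: ifP => _; rewrite ?mulr0 ?mul0r // ler_wpM2l ?mulr_ge0 // dev_le.
rewrite (bigID (fun a => U < a)%N) /=.
under eq_bigr do rewrite (bigID (fun b => U < b)%N) /=.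
under [X in _ + X]eq_bigr do rewrite (bigID (fun b => U < b)%N) /=.
rewrite !big_split /=.
have h2 : \sum_(1 <= a < V.+1 | (U < a)%N) \sum_(1 <= b < V.+1 | ~~ (U < b)%N) X a b <=
    2 * mixed_const alpha beta * E.
  apply: le_trans RL; rewrite (exchange_big_dep xpredT) //=.
  apply: le_trans (sum_low U V _); last by move=> n; apply: sumr_ge0.
  rewrite [leRHS]big_mkcond; apply: ler_sum => b _.
  case: ifP => bU; last by rewrite big1 // => a; rewrite andbF.
  by under eq_bigl do rewrite andbT.
have h3 : \sum_(1 <= a < V.+1 | ~~ (U < a)%N) \sum_(1 <= b < V.+1 | (U < b)%N) X a b <=
    2 * mixed_const beta alpha * E.
  by apply: le_trans LR; apply: sum_low => n; apply: sumr_ge0.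
have h4 : \sum_(1 <= a < V.+1 | ~~ (U < a)%N) \sum_(1 <= b < V.+1 | ~~ (U < b)%N) X a b <=
    K1 * E.
  apply: le_trans LL; apply: le_trans (sum_low U V _) _.
    by move=> n; apply: sumr_ge0.
  by apply: ler_sum => a _; apply: sum_low.
apply: le_trans (lerD (lerD RR h2) (lerD h3 h4)) _.
by rewrite le_eqVlt; apply/predU1P; left; ring.
Qed.

Lemma sum_gcd_high p q V M : 0 < p -> 0 < q -> (0 < V)%N ->
  \sum_(1 <= a < M.+1) \sum_(1 <= b < M.+1)
     (gcdn a b)%:R * (high V (1 + p) a * negpow (1 + q) b) <=
  (1 + p^-1) * (1 + q^-1) ^+ 2 * negpow p V.
Proof.
move=> p0 q0 V0; apply: le_trans (sum_gcd_mul _ _ _) _ => //.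
have P0 : 0 <= 1 + p^-1 by rewrite addr_ge0 // invr_ge0 ltW.
have Q0 : 0 <= 1 + q^-1 by rewrite addr_ge0 // invr_ge0 ltW.
apply: (@le_trans _ _ (\sum_(1 <= d < M.+1)
   (1 + p^-1) * (1 + q^-1) * negpow p V * negpow (1 + q) d)); last first.
  rewrite -mulr_sumr expr2 mulrA -[leRHS]mulrA (mulrC (1 + q^-1)) mulrA.
  by rewrite ler_wpM2l ?mulr_ge0 // zeta_sum_gt1.
apply: ler_sum_nat_cond => d /andP[d0 _] _.
apply: (@le_trans _ _ (d%:R * ((negpow (1 + p) d * ((1 + p^-1) * (negpow p V * negpow (- p) d))) *
   (negpow (1 + q) d * (1 + q^-1))))).
  rewrite ler_wpM2l // ler_pM ?sumr_ge0 //.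
    rewrite /high -big_mkcond /=.
    under eq_bigr do rewrite negpowM.
    under eq_bigl do rewrite mulnC.
    by rewrite -mulr_sumr ler_wpM2l // zeta_sum_tail_div.
  under eq_bigr do rewrite negpowM.
  by rewrite -mulr_sumr ler_wpM2l // zeta_sum_gt1.
have dK : d%:R * negpow 1 d = 1 :> R by rewrite negpow1 divff // pnatr_eq0 -lt0n.
rewrite !(negpowD 1) // le_eqVlt; apply/predU1P; left.
rewrite -[RHS]mulr1 -[X in _ = _ * X]dK.
rewrite -[RHS]mulr1 -[X in _ = _ * X](negpowVK p d0).
ring.
Qed.

(** This bound, uniform in [M], gives both the convergence of the double series
    and its rate. *)
Lemma sum_lcm_outside_box p q V M : 0 < p -> p <= q -> (0 < V)%N ->
  \sum_(1 <= a < M.+1) \sum_(1 <= b < M.+1 | (V < a)%N || (V < b)%N)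
     negpow p a * negpow q b / (lcmn a b)%:R <=
  ((1 + p^-1) * (1 + q^-1) ^+ 2 + (1 + q^-1) * (1 + p^-1) ^+ 2) * negpow p V.
Proof.
move=> p0 pq V0; have q0 : 0 < q by lra.
have P0 : 0 <= 1 + p^-1 by rewrite addr_ge0 // invr_ge0 ltW.
have Q0 : 0 <= 1 + q^-1 by rewrite addr_ge0 // invr_ge0 ltW.
have h1 := sum_gcd_high M p0 q0 V0.
have h2 := sum_gcd_high M q0 p0 V0.
have h3 : negpow q V <= negpow p V by apply: negpow_le.
have h4 : (1 + q^-1) * (1 + p^-1) ^+ 2 * negpow q V <= (1 + q^-1) * (1 + p^-1) ^+ 2 * negpow p V.
  by rewrite ler_wpM2l // mulr_ge0 // exprn_ge0.
rewrite mulrDl; apply: le_trans (lerD h1 (le_trans h2 h4)).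
rewrite [X in _ <= _ + X]exchange_big /= -big_split /=.
apply: ler_sum_nat_cond => a /andP[a0 _] _; rewrite -big_split /= big_mkcond.
apply: ler_sum_nat_cond => b /andP[b0 _] _; rewrite (gcdnC b a) inv_lcm //.
have -> : negpow p a * negpow q b * ((gcdn a b)%:R * (negpow 1 a * negpow 1 b)) =
   (gcdn a b)%:R * (negpow (1 + p) a * negpow (1 + q) b).
  by rewrite !(negpowD 1) //; ring.
rewrite /high -mulrDr.
case: (V < a)%N; case: (V < b)%N => /=; rewrite ?mul0r ?mulr0 ?addr0 ?add0r //.
  by rewrite ler_wpM2l // lerDl mulr_ge0.
  by rewrite (mulrC (negpow (1 + q) b)).
by rewrite mulr0.
Qed.

End Assembly.

(** * Comparison with the error function *)

Section ErrorFunction.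
Variable R : realType.
Implicit Types (s t p q r x y alpha beta : R) (N M d m n U V : nat).

(** A square is convenient for the hyperbola method, so [x] is replaced by the
    square of an integer of the same order, large enough for all divisors
    [a], [b] that occur. *)
Definition side x : nat := (Num.truncn (Num.sqrt (2 * x))).+1.

Lemma side_bounds x : 2 <= x ->
  [/\ 2 * x <= (side x * side x)%:R, (side x * side x)%:R <= 5 * x & (1 < side x)%N].
Proof.
move=> x2; set s := Num.sqrt (2 * x).
have s0 : 0 <= s by exact: sqrtr_ge0.
have ss : s * s = 2 * x by rewrite -expr2 sqr_sqrtr //; lra.
have sx : s <= x.
  rewrite -(@ler_pXn2r _ 2) ?nnegrE //; last by lra.
  by rewrite !expr2 ss; nra.
have s2 : 2 <= s by rewrite -(@ler_pXn2r _ 2) ?nnegrE // !expr2 ss; lra.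
have /andP[h1 h2] := truncn_itv s0.
rewrite natrM; split.
- by rewrite -ss ler_pM // ltW.
- have h : (side x)%:R <= s + 1 by rewrite /side -natr1 lerD2r.
  apply: (@le_trans _ _ ((s + 1) * (s + 1))); first by rewrite ler_pM.
  by nra.
- rewrite -(ltr_nat R); apply: le_lt_trans h2; lra.
Qed.

Let ln2_gt0 : 0 < ln 2 :> R.
Proof. by rewrite ln_gt0 // ltr1n. Qed.

Lemma ln_side x : 2 <= x -> ln (side x * side x)%:R <= 4 * ln x.
Proof.
move=> x2; have [h1 h2 h3] := side_bounds x2.
have x0 : 0 < x by lra.
have -> : 4 * ln x = ln (x ^+ 4) by rewrite lnXn // mulr_natl.
have V0 : 0 < (side x * side x)%:R :> R by apply: lt_le_trans h1; lra.
rewrite ler_ln ?posrE ?exprn_gt0 //.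
apply: le_trans h2 _; rewrite exprS mulrC ler_pM2l //.
by rewrite !exprS expr0 mulr1; nra.
Qed.

Lemma powR_side s x : 2 <= x -> 0 <= s -> s <= 1 ->
  negpow (- s) (side x * side x) <= 5 * x `^ s.
Proof.
move=> x2 s0 s1; have [h1 h2 h3] := side_bounds x2.
have x0 : 0 < x by lra.
rewrite /negpow opprK; apply: (@le_trans _ _ ((5 * x) `^ s)).
  by rewrite ge0_ler_powR ?nnegrE //; lra.
rewrite powRM //; last by lra.
rewrite ler_wpM2r ?powR_ge0 //; apply: ler1_powR => //; lra.
Qed.

(** The error function is bounded below, so that it absorbs constants. *)
Lemma Eerr_ge x alpha beta : 2 <= x -> 0 < alpha -> 1 <= (1 + (ln 2)^-1) ^+ 2 * Eerr x alpha beta.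
Proof.
move=> x2 a0; have x0 : 0 < x by lra.
have lx : ln 2 <= ln x by rewrite ler_ln ?posrE //.
have l0 : 0 <= ln x by apply: le_trans lx; exact: ltW.
set c := 1 + (ln 2)^-1.
have c1 : 1 <= c by rewrite lerDl invr_ge0 ltW.
have cl : 1 <= c * ln x.
  apply: (@le_trans _ _ ((ln 2)^-1 * ln x)).
    by rewrite ler_pdivlMl // mulr1.
  by rewrite ler_wpM2r ?lerDr.
have c0 : 0 <= c by apply: le_trans c1.
have c2 : c <= c ^+ 2 by rewrite expr2 ler_peMr.
have c20 : 0 <= c ^+ 2 by rewrite exprn_ge0.
have c21 : 1 <= c ^+ 2 by apply: le_trans c2.
rewrite /Eerr; case: ifP => a1.
  have p1 : 1 <= x `^ (1 - alpha).
    by rewrite -[leLHS](powRr0 x) ler_powR //; lra.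
  case: ifP => _; first by apply: le_trans c21 _; rewrite ler_peMr.
  apply: le_trans cl _; apply: ler_pM => //.
  by rewrite ler_peMl.
case: ifP => _; last by rewrite mulr1.
case: ifP => _; first by apply: le_trans cl _; rewrite ler_wpM2r.
by rewrite -exprMn; apply: exprn_ege1.
Qed.

Lemma Eerr_ge0 x alpha beta : 2 <= x -> 0 <= Eerr x alpha beta.
Proof.
move=> x2; have l0 : 0 <= ln x by rewrite ln_ge0 //; lra.
rewrite /Eerr; case: ifP => _; case: ifP => _ //; rewrite ?powR_ge0 ?mulr_ge0 ?powR_ge0 //.
by case: ifP => // _; rewrite exprn_ge0.
Qed.

Lemma Eerr_tail alpha beta : 0 < alpha -> exists2 K : R, 0 <= K & forall x, 2 <= x ->
  (side x * side x)%:R * negpow alpha (side x * side x) <= K * Eerr x alpha beta.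
Proof.
move=> a0; set c := 1 + (ln 2 : R)^-1.
have c0 : 0 <= c by rewrite addr_ge0 // invr_ge0 ltW.
exists (c ^+ 2 * 5); first by rewrite mulr_ge0 // exprn_ge0.
move=> x x2; have [h1 h2 h3] := side_bounds x2.
have V0 : (0 < side x * side x)%N by rewrite muln_gt0 /=; lia.
have E1 := Eerr_ge beta x2 a0; rewrite -/c in E1.
rewrite natr_negpow -negpowD //.
case: (ltP alpha 1) => a1.
  have -> : -1 + alpha = - (1 - alpha) by ring.
  have l1 : 0 <= 1 - alpha by lra.
  apply: le_trans (powR_side x2 l1 _) _; first by lra.
  have lx : ln 2 <= ln x by rewrite ler_ln ?posrE //; lra.
  have l0 : 0 <= ln x by apply: le_trans lx; exact: ltW.
  have p0 := powR_ge0 x (1 - alpha).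
  rewrite -mulrA mulrCA ler_wpM2l //.
  have cl : 1 <= c * ln x.
    apply: (@le_trans _ _ ((ln 2)^-1 * ln x)).
      by rewrite ler_pdivlMl // mulr1.
    by rewrite ler_wpM2r ?lerDr.
  have c1 : 1 <= c by rewrite lerDl invr_ge0 ltW.
  have c21 : 1 <= c ^+ 2 by exact: exprn_ege1.
  rewrite /Eerr a1; case: ifP => _; first by rewrite ler_peMl.
  rewrite mulrCA ler_peMr //; apply: le_trans cl _; rewrite ler_wpM2r //.
  by rewrite expr2 ler_peMr.
apply: (@le_trans _ _ 1).
  rewrite -[leRHS](negpow0 R (side x * side x)); apply: negpow_le => //; lra.
by rewrite -mulrA mulrCA; lra.
Qed.

Lemma zeta_sum_side x : 2 <= x -> zeta_sum 1 (side x) <= 4 * (1 + (ln 2)^-1) * ln x.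
Proof.
move=> x2; have [h1 h2 h3] := side_bounds x2.
have c0 : 0 <= 1 + (ln 2 : R)^-1 by rewrite addr_ge0 // invr_ge0 ltW.
apply: le_trans (zeta_sum_harmonic _ h3) _.
rewrite -mulrA mulrCA ler_wpM2l //; apply: le_trans (ln_side x2).
have U0 : (0 < side x)%N by lia.
by rewrite ler_ln ?posrE ?ltr0n ?muln_gt0 ?U0 // ler_nat leq_pmulr.
Qed.

Lemma zeta_sum_side_sq x : 2 <= x -> zeta_sum 1 (side x * side x) <= 4 * (1 + (ln 2)^-1) * ln x.
Proof.
move=> x2; have [h1 h2 h3] := side_bounds x2.
have c0 : 0 <= 1 + (ln 2 : R)^-1 by rewrite addr_ge0 // invr_ge0 ltW.
apply: le_trans (zeta_sum_harmonic _ _) _; first by nia.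
by rewrite -mulrA mulrCA ler_wpM2l // ln_side.
Qed.

(** For [alpha >= 1] an error 1 for each pair of the box is affordable. For
    [alpha < 1] the finer [dev_bound] applies, after [beta] has been lowered
    below 1 if necessary. *)
Lemma dev_Eerr alpha beta : 0 < alpha -> alpha <= beta ->
  exists2 K : R, 0 <= K & forall x T i j, 2 <= x ->
    (T + i <= side x * side x)%N -> (T + j <= side x * side x)%N ->
    i = 0%N \/ j = 0%N ->
    \sum_(1 <= a < (side x * side x).+1) \sum_(1 <= b < (side x * side x).+1)
       negpow alpha a * negpow beta b * dev R a b i j T <=
    K * Eerr x alpha beta.
Proof.
move=> a0 ab; have b0 : 0 < beta by lra.
set c := 4 * (1 + (ln 2 : R)^-1).
have c0 : 0 <= c by rewrite mulr_ge0 // addr_ge0 // invr_ge0 ltW.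
have gt1 s N : 1 < s -> zeta_sum s N <= 1 + (s - 1)^-1.
  by move=> s1; rewrite -{1}(subrKC 1 s) zeta_sum_gt1 // subr_gt0.
case: (ltP alpha 1) => a1; last first.
  have [a2|a2] := ltP 1 alpha.
    exists ((1 + (alpha - 1)^-1) * (1 + (beta - 1)^-1)).
      by rewrite mulr_ge0 // addr_ge0 // invr_ge0; lra.
    move=> x T i j x2 _ _ ij; apply: le_trans (dev_box _ _ _ _ ij) _.
    rewrite /Eerr ltNge a1 /= gt_eqF // mulr1 ler_pM ?gt1 //; lra.
  have {a1 a2} a1 : alpha = 1 by apply/eqP; rewrite eq_le a1 a2.
  have [b1|b1] := ltP 1 beta.
    exists (c * (1 + (beta - 1)^-1)).
      by rewrite mulr_ge0 // addr_ge0 // invr_ge0; lra.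
    move=> x T i j x2 _ _ ij; apply: le_trans (dev_box _ _ _ _ ij) _.
    rewrite /Eerr a1 ltxx eqxx b1 mulrAC ler_pM ?gt1 // zeta_sum_side_sq //.
  have {b1} b1 : beta = 1 by apply/eqP; rewrite eq_le b1 -a1 ab.
  exists (c ^+ 2); first by rewrite exprn_ge0.
  move=> x T i j x2 _ _ ij; apply: le_trans (dev_box _ _ _ _ ij) _.
  rewrite /Eerr a1 b1 ltxx eqxx -exprMn expr2.
  by apply: ler_pM => //; exact: zeta_sum_side_sq.
have l0 : 0 <= 1 - alpha by lra.
have pw x : 2 <= x -> negpow (2 * alpha - 2) (side x) <= 5 * x `^ (1 - alpha).
  move=> x2; have [_ _ h3] := side_bounds x2.
  apply: le_trans (powR_side x2 l0 _); last by lra.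
  rewrite negpowM -negpowD; last by lia.
  by rewrite le_eqVlt; apply/predU1P; left; congr (negpow _ _); ring.
have side0 x : 2 <= x -> (0 < side x)%N by [].
move: ab; rewrite le_eqVlt => /predU1P[ab|ab].
  have [K K0 H] := dev_bound a0 (lexx _) a1.
  exists (K * (5 * c)); first by rewrite mulr_ge0 // mulr_ge0.
  move=> x T i j x2 Ti Tj ij; rewrite -ab.
  apply: le_trans (H _ _ _ _ (side0 x x2) Ti Tj ij) _.
  rewrite -mulrA ler_wpM2l // /Eerr a1 ltxx addrK mulrACA.
  by apply: ler_pM => //; [exact: pw | exact: zeta_sum_side].
(* Since alpha < gam still holds, the error function is the same for gam. *)
pose gam := Num.min beta ((1 + alpha) / 2).
have ag : alpha < gam by rewrite /gam lt_min ab /=; lra.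
have g1 : gam < 1 by rewrite /gam gt_min; apply/orP; right; lra.
have gb : gam <= beta by rewrite /gam ge_min lexx.
have [K K0 H] := dev_bound a0 (ltW ag) g1.
have Z0 : 0 <= 1 + (gam - alpha)^-1 by rewrite addr_ge0 // invr_ge0; lra.
exists (K * (5 * (1 + (gam - alpha)^-1))); first by rewrite mulr_ge0 // mulr_ge0.
move=> x T i j x2 Ti Tj ij.
apply: le_trans (_ : K * (negpow (2 * alpha - 2) (side x) * zeta_sum (1 + gam - alpha) (side x)) <= _).
  apply: le_trans (H _ _ _ _ (side0 x x2) Ti Tj ij).
  apply: ler_sum => a _; apply: ler_sum_nat_cond => b /andP[b0' _] _.
  by rewrite ler_wpM2r ?dev_ge0 // ler_wpM2l // negpow_le.
rewrite -mulrA ler_wpM2l // /Eerr a1 ab mulrAC.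
apply: ler_pM => //; first exact: pw.
by rewrite -addrA zeta_sum_gt1 // subr_gt0.
Qed.

End ErrorFunction.

(** * Unordered sums of complex numbers *)

#[local] Existing Instance totally_filter.

Section Summability.
Variable R : realType.
Implicit Types (z : R[i]) (n m : nat).

Lemma normc_realE (k : R) : `|k%:C| = `|k|%:C :> R[i].
Proof. by rewrite normc_def /= expr0n addr0 sqrtr_sqr. Qed.

Lemma norm_Re_le z (k : R) : `|z| <= k%:C -> `|complex.Re z| <= k.
Proof. by move=> h; rewrite -lecR; apply: le_trans (normc_ge_Re z) h. Qed.

Lemma norm_Im_le z (k : R) : `|z| <= k%:C -> `|complex.Im z| <= k.
Proof.
rewrite normc_def lecR; apply: le_trans.
by rewrite -sqrtr_sqr ler_wsqrtr // lerDr sqr_ge0.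
Qed.

Lemma norm_le_Re_Im z (k l : R) : `|complex.Re z| <= k -> `|complex.Im z| <= l -> `|z| <= (k + l)%:C.
Proof.
move=> hk hl; rewrite [z]complexE rmorphD; apply: le_trans (ler_normD _ _) _.
apply: lerD; first by rewrite normc_realE lecR.
have i1 : `|'i%C| = 1 :> R[i] by rewrite normc_def /= expr0n expr1n add0r sqrtr1.
by rewrite normrM i1 mul1r normc_realE lecR.
Qed.

(** The limit is the supremum of the lower bounds [u m - eps m], which all lie
    below the upper bounds [u n + eps n]. *)
Lemma cauchy_rate (u eps : nat -> R) :
  (forall n m, (0 < n <= m)%N -> `|u m - u n| <= eps n) ->
  exists l, forall n, (0 < n)%N -> `|l - u n| <= eps n.
Proof.
move=> H.
pose S := [set y | exists2 m, (0 < m)%N & y = u m - eps m].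
have ubS n : (0 < n)%N -> ubound S (u n + eps n).
  move=> n0 _ [m m0 ->].
  case: (leqP n m) => nm.
    have := H n m; rewrite n0 nm => /(_ isT); rewrite ler_distl => /andP[_ h].
    have e0 : 0 <= eps m by apply: le_trans (normr_ge0 _) (H m m _); rewrite m0 leqnn.
    lra.
  have := H m n; rewrite m0 ltnW // => /(_ isT); rewrite ler_distl => /andP[h _].
  have e0 : 0 <= eps n by apply: le_trans (normr_ge0 _) (H n n _); rewrite n0 leqnn.
  lra.
exists (sup S) => n n0.
rewrite ler_distl; apply/andP; split.
  by apply: (ub_le_sup (E := S)); [exists (u n + eps n); exact: ubS | exists n].
apply: ge_sup; last exact: ubS.
by exists (u 1%N - eps 1%N); exists 1%N.
Qed.

Definition box_seq n : seq (nat * nat) :=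
  [seq (a, b) | a <- index_iota 1 n.+1, b <- index_iota 1 n.+1].

Lemma mem_box n p : (p \in box_seq n) = (0 < p.1 <= n)%N && (0 < p.2 <= n)%N.
Proof.
apply/allpairsP/andP => [[[a b] /= [+ + ->]]|[h1 h2]].
  by rewrite !mem_index_iota !ltnS.
by exists p; rewrite !mem_index_iota !ltnS; split=> //; case: (p).
Qed.

Lemma box_uniq n : uniq (box_seq n).
Proof. by apply: allpairs_uniq; rewrite ?iota_uniq // => -[a b] [c d]. Qed.

Definition box_sum (x : nat * nat -> R[i]) n : R[i] :=
  \sum_(1 <= a < n.+1) \sum_(1 <= b < n.+1) x (a, b).

Lemma box_sumE x n : box_sum x n = \sum_(p <- box_seq n) x p.
Proof. by rewrite /box_sum /box_seq big_allpairs. Qed.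

Definition box n : {fset nat * nat} := seq_fset tt (box_seq n).

Section Family.
Variables (x : nat * nat -> R[i]^o) (c : nat * nat -> R) (eps : nat -> R).
Hypothesis xc : forall p, `|x p : R[i]| <= (c p)%:C.
Hypothesis x0 : forall p, ~~ ((0 < p.1)%N && (0 < p.2)%N) -> x p = 0.
Hypothesis tail : forall n m, (0 < n)%N ->
  \sum_(1 <= a < m.+1) \sum_(1 <= b < m.+1 | (n < a)%N || (n < b)%N) c (a, b) <= eps n.
Hypothesis eps0 : forall e : R, 0 < e -> exists2 n, (0 < n)%N & eps n <= e.

Let c_ge0 p : 0 <= c p.
Proof. by rewrite -ler0c; apply: le_trans (xc p). Qed.

(** A finite set of indices that contains a box sits inside a larger box, and
    the terms between the two boxes are controlled by the tail. *)
Lemma finite_sum_near (s : seq (nat * nat)) n : (0 < n)%N -> uniq s ->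
  {subset box_seq n <= s} ->
  `|\sum_(p <- s) x p - box_sum x n : R[i]| <= (eps n)%:C.
Proof.
move=> n0 us ss; rewrite box_sumE (bigID (mem (box_seq n))) /=.
have -> : \sum_(p <- s | p \in box_seq n) x p = \sum_(p <- box_seq n) x p.
  rewrite -big_filter; apply: perm_big; apply: uniq_perm; rewrite ?filter_uniq ?box_uniq //.
  by move=> p; rewrite mem_filter andb_idr // => /ss.
rewrite addrAC subrr add0r.
pose Q p := (0 < p.1)%N && (0 < p.2)%N.
have -> : \sum_(p <- s | p \notin box_seq n) x p =
   \sum_(p <- s | (p \notin box_seq n) && Q p) x p.
  rewrite big_mkcondr; apply: eq_bigr => p _; case: ifPn => // Qp; exact: x0.
apply: le_trans (ler_norm_sum _ _ _) _.
apply: (@le_trans _ _ ((\sum_(p <- s | (p \notin box_seq n) && Q p) c p)%:C)).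
  by rewrite rmorph_sum /=; apply: ler_sum => p _; exact: xc.
rewrite lecR.
pose m := (\max_(p <- s) maxn p.1 p.2)%N.
apply: le_trans (tail m n0).
have -> : \sum_(1 <= a < m.+1) \sum_(1 <= b < m.+1 | (n < a)%N || (n < b)%N) c (a, b) =
   \sum_(p <- box_seq m | (n < p.1)%N || (n < p.2)%N) c p.
  rewrite [RHS]big_mkcond big_allpairs /=; apply: eq_bigr => a _.
  by rewrite big_mkcond.
apply: (@ler_sum_inj _ _ _ _ _ _ _ id); rewrite ?box_uniq // => p ps /andP[].
rewrite !mem_box /Q /= => pn /andP[p1 p2].
have : (maxn p.1 p.2 <= m)%N by exact: (leq_bigmax_seq (F := fun p => maxn p.1 p.2)).
rewrite geq_max => /andP[q1 q2]; rewrite p1 p2 q1 q2; split=> //.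
by move: pn; rewrite p1 p2 /= negb_and -!ltnNge.
Qed.

(** The limit of the box sums, obtained from those of the real and imaginary
    parts, is also the limit along all finite sets of indices. *)
Lemma partial_sum_cvg : exists L : R[i]^o,
  partial_sum x @ totally --> L /\
  forall n, (0 < n)%N -> `|(L : R[i]) - box_sum x n| <= (2 * eps n)%:C.
Proof.
have H n m : (0 < n <= m)%N -> `|box_sum x m - box_sum x n| <= (eps n)%:C.
  move=> /andP[n0 nm]; rewrite {1}box_sumE; apply: finite_sum_near; rewrite ?box_uniq //.
  by move=> p; rewrite !mem_box; lia.
have [l1 h1] : exists l, forall n, (0 < n)%N -> `|l - complex.Re (box_sum x n)| <= eps n.
  apply: (cauchy_rate (u := fun n => complex.Re (box_sum x n))) => n m nm.
  have := norm_Re_le (H n m nm); by rewrite raddfB.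
have [l2 h2] : exists l, forall n, (0 < n)%N -> `|l - complex.Im (box_sum x n)| <= eps n.
  apply: (cauchy_rate (u := fun n => complex.Im (box_sum x n))) => n m nm.
  have := norm_Im_le (H n m nm); by rewrite raddfB.
pose L : R[i] := (l1 +i* l2)%C.
have HL n : (0 < n)%N -> `|L - box_sum x n| <= (2 * eps n)%:C.
  move=> n0; rewrite mulr_natl mulr2n; apply: norm_le_Re_Im; rewrite raddfB; [exact: h1 | exact: h2].
exists L; split=> //; apply/cvgrPdist_le => e e0.
have [e' ee e'0] : exists2 e', e = e'%:C & 0 < e'.
  case: e e0 => e1 e2; rewrite ltcE /= => /andP[/eqP -> h]; by exists e1.
have [n n0 en] : exists2 n, (0 < n)%N & eps n <= e' / 3 by apply: eps0; rewrite divr_gt0.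
(* The approximation costs 2 * eps n for L and eps n for J. *)
exists (box n) => // J /= bJ.
have -> : partial_sum x J = \sum_(p <- J) x p by rewrite /partial_sum big_seq_fsetE.
have : `|\sum_(p <- J) x p - box_sum x n : R[i]| <= (eps n)%:C.
  apply: finite_sum_near => //; first exact: fset_uniq.
  by move=> p pb; apply: (fsubsetP bJ); rewrite seq_fsetE.
move=> h; rewrite ee.
have -> : L - \sum_(p <- J) x p = (L - box_sum x n) - (\sum_(p <- J) x p - box_sum x n).
  by rewrite opprB addrA subrK.
apply: le_trans (ler_normB _ _) _; apply: le_trans (lerD (HL n n0) h) _.
rewrite -rmorphD lecR; lra.
Qed.

End Family.

End Summability.

(** * From arithmetic functions to the count of solutions *)

Section Reduction.
Variable R : realType.
Implicit Types (f g : nat -> R[i]) (h : int) (a b i j T V n : nat).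

Lemma conv1_nat f n V : (0 < n <= V)%N ->
  conv1 f n%:Z = \sum_(1 <= a < V.+1 | (a %| n)%N) f a.
Proof.
move=> /andP[n0 nV]; rewrite /conv1 ltz_nat n0 absz_nat -[RHS]big_filter.
apply: perm_big; apply: uniq_perm; rewrite ?divisors_uniq ?filter_uniq ?iota_uniq //.
move=> d; rewrite mem_filter mem_index_iota ltnS -dvdn_divisors // andb_idr // => dn.
by rewrite (dvdn_gt0 n0 dn) (leq_trans (dvdn_leq n0 dn) nV).
Qed.

(** Any [V] that bounds the arguments of [conv1] also bounds their divisors. *)
Lemma conv1_shift_sum f g i j T V : (T + i <= V)%N -> (T + j <= V)%N ->
  \sum_(1 <= t < T.+1) conv1 f (t + i)%N%:Z * conv1 g (t + j)%N%:Z =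
  \sum_(1 <= a < V.+1) \sum_(1 <= b < V.+1) f a * g b * (hits a b i j T)%:R.
Proof.
move=> Ti Tj; under [RHS]eq_bigr => a _ do under eq_bigr => b _ do rewrite hits_sum.
rewrite (sum_mul_common V T (fun a t => a %| t + i)%N (fun b t => b %| t + j)%N).
rewrite [LHS]big_nat_cond [RHS]big_nat_cond; apply: eq_bigr => t /andP[/andP[t0 tT] _].
by rewrite !(@conv1_nat _ _ V) //; lia.
Qed.

(** Take [(i, j) = (0, - h)] for [h <= 0] and [(i, j) = (h, 0)] for [h > 0]. In
    the second case the term [n = h] is dropped: there the second factor is
    taken at 0 and vanishes. *)
Lemma shifted_sum_nat f g (x : R) h : 2 <= x -> `|h|%:~R <= x / 2 ->
  exists T i j,
    [/\ i = 0%N \/ j = 0%N, `|h|%N = (i + j)%N,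
        ((T + i)%:R <= 2 * x) /\ ((T + j)%:R <= 2 * x),
        `|T%:R - (x - (Hstart h)%:~R)| <= 1 &
        shifted_sum f g x h =
        \sum_(1 <= t < T.+1) conv1 f (t + i)%N%:Z * conv1 g (t + j)%N%:Z].
Proof.
move=> x2 hx; have x0 : 0 <= x by lra.
set N := Num.truncn x.
have /andP[N1 N2] : N%:R <= x < N.+1%:R := truncn_itv x0.
rewrite -natr1 in N2.
have hk : (`|h|%N%:R : R) <= x / 2 by move: hx; rewrite -abszE.
case: (lerP h 0) => h0.
  exists N, 0%N, `|h|%N; split; first by left.
  - by [].
  - by rewrite addn0 natrD; split; lra.
  - by rewrite /Hstart h0 ler_norml; apply/andP; split; lra.
  rewrite /shifted_sum -/N /Hstart h0 big_mkcond big_ltn //= add0r.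
  rewrite big_nat_cond [RHS]big_nat_cond; apply: eq_bigr => t /andP[/andP[t0 _] _].
  rewrite lez_nat t0 addn0; congr (_ * conv1 g _).
  by rewrite PoszD (lez0_abs h0).
have [k hE k0] : exists2 k : nat, h = k%:Z & (0 < k)%N.
  by exists `|h|%N; [rewrite gtz0_abs | rewrite absz_gt0 gt_eqF].
rewrite hE absz_nat in hk *.
have kN : (k <= N)%N by rewrite truncn_ge_nat //; lra.
have NkR : (N - k)%:R = N%:R - k%:R :> R by rewrite natrB.
exists (N - k)%N, k, 0%N; split; first by right.
- by rewrite addn0.
- by rewrite addn0 subnK // NkR; split; have : 0 <= k%:R :> R by []; lra.
- have -> : Hstart k = k by rewrite /Hstart lez_nat leqNgt k0.
  by rewrite NkR ler_norml -pmulrn; apply/andP; split; lra.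
rewrite /shifted_sum -/N.
have -> : Hstart k = k by rewrite /Hstart lez_nat leqNgt k0.
transitivity (\sum_(k <= n < N.+1) conv1 f n%:Z * conv1 g (n%:Z - k%:Z)).
  rewrite [RHS](big_nat_widenl _ 0) //; apply: eq_bigl => n; exact: lez_nat.
rewrite -{1}[k]add0n big_addn subSn // big_ltn //.
rewrite add0n subrr {2}/conv1 ltxx mulr0 add0r.
by apply: eq_bigr => t _; rewrite addn0 PoszD addrK.
Qed.

Lemma bigO_pow_ge0 (A alpha : R) f : bigO_pow A alpha f -> 0 <= A.
Proof.
move=> /(_ 1%N isT); rewrite powR1 mulr1 => h.
by rewrite -ler0c; apply: le_trans h.
Qed.

Section Series.
Variables (alpha beta A B : R) (f g : nat -> R[i]).
Hypotheses (a0 : 0 < alpha) (ab : alpha <= beta).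
Hypotheses (fA : bigO_pow A alpha f) (gB : bigO_pow B beta g).

Let A0 : 0 <= A := bigO_pow_ge0 fA.
Let B0 : 0 <= B := bigO_pow_ge0 gB.

Lemma mul_bigO a b : (0 < a)%N -> (0 < b)%N ->
  `|f a * g b| <= (A * B * (negpow alpha a * negpow beta b))%:C.
Proof.
move=> a1 b1; rewrite normrM mulrACA rmorphM.
by apply: ler_pM => //; [exact: fA | exact: gB].
Qed.

Definition tail_const : R :=
  (1 + alpha^-1) * (1 + beta^-1) ^+ 2 + (1 + beta^-1) * (1 + alpha^-1) ^+ 2.

Lemma tail_const_ge0 : 0 <= tail_const.
Proof.
have b0 : 0 < beta := lt_le_trans a0 ab.
by rewrite /tail_const addr_ge0 // mulr_ge0 ?exprn_ge0 // addr_ge0 // invr_ge0 ltW.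
Qed.

(** The tail of the double series outside of a box is that of
    [sum_lcm_outside_box]. *)
Lemma Cterm_limit h : exists L : R[i]^o,
  partial_sum (Cterm f g h) @ totally --> L /\
  forall n, (0 < n)%N ->
    `|(L : R[i]) - box_sum (Cterm f g h) n| <=
    (2 * (A * B * tail_const * negpow alpha n))%:C.
Proof.
have AB0 : 0 <= A * B by rewrite mulr_ge0.
have K0 := tail_const_ge0.
pose c (p : nat * nat) : R := if (0 < p.1)%N && (0 < p.2)%N then
  A * B * (negpow alpha p.1 * negpow beta p.2 / (lcmn p.1 p.2)%:R) else 0.
apply: (@partial_sum_cvg _ _ c (fun n => A * B * tail_const * negpow alpha n)).
- case=> a b; rewrite /Cterm /c /=.
  case: (posnP a) => [->|a1] /=; first by rewrite normr0.
  case: (posnP b) => [->|b1] /=; first by rewrite normr0.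
  have L0 : (0 <= (lcmn a b)%:R^-1 :> R) by rewrite invr_ge0.
  case: ifP => _.
    rewrite normrM normfV normr_nat mulrA rmorphM /= fmorphV rmorph_nat.
    by apply: ler_wpM2r; [rewrite invr_ge0 | exact: mul_bigO].
  by rewrite normr0 ler0c !mulr_ge0.
- by case=> a b /=; rewrite negb_and -!eqn0Ngt => /orP[] /eqP ->; rewrite ?andbF.
- move=> n m n0; have := sum_lcm_outside_box m a0 ab n0.
  move=> /(ler_wpM2l AB0); rewrite mulrA; apply: le_trans.
  rewrite mulr_sumr; apply: ler_sum_nat_cond => a /andP[a1 _] _.
  rewrite mulr_sumr; apply: ler_sum_nat_cond => b /andP[b1 _] _.
  by rewrite /c a1 b1.
move=> e e0; pose K := A * B * tail_const + 1.
have K1 : 0 < K by rewrite ltr_wpDl // mulr_ge0.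
pose y := (K / e) `^ alpha^-1; have y0 : 0 <= y by exact: powR_ge0.
exists (Num.truncn y).+1 => //; have /andP[_ yn] := truncn_itv y0.
set n := (Num.truncn y).+1 in yn *.
have en : K * negpow alpha n <= e.
  rewrite /negpow powRN ler_pdivrMr ?powR_gt0 ?ltr0n // -ler_pdivrMl //.
  rewrite mulrC; apply: (@le_trans _ _ (y `^ alpha)).
    by rewrite /y -powRrM mulVf ?gt_eqF // powRr1 // divr_ge0 ?ltW.
  by rewrite ge0_ler_powR ?nnegrE // ltW.
by apply: le_trans en; rewrite ler_wpM2r // /K lerDl.
Qed.

Lemma Cconverges_of_bigO h : Cconverges f g h.
Proof. by have [L [cL _]] := Cterm_limit h; apply/cvg_ex; exists L. Qed.

Lemma Cseries_box h n : (0 < n)%N ->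
  `|Cseries f g h - box_sum (Cterm f g h) n| <=
  (2 * (A * B * tail_const * negpow alpha n))%:C.
Proof.
move=> n0; have [L [cL HL]] := Cterm_limit h.
have -> : Cseries f g h = L by exact: (cvg_lim (@norm_hausdorff _ _) cL).
exact: HL.
Qed.

Lemma Cseries_le h : `|Cseries f g h| <= (A * B * (1 + 2 * tail_const))%:C.
Proof.
have h1 := Cseries_box h (ltn0Sn 0).
have h2 : `|box_sum (Cterm f g h) 1 : R[i]| <= (A * B)%:C.
  rewrite /box_sum !big_nat1 /Cterm /= gcdn1 dvd1z divr1.
  by have := @mul_bigO 1 1 isT isT; rewrite !negpow1n !mulr1.
rewrite -(subrK (box_sum (Cterm f g h) 1) (Cseries f g h)).
apply: le_trans (ler_normD _ _) _; apply: le_trans (lerD h1 h2) _.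
rewrite -rmorphD lecR negpow1n le_eqVlt; apply/predU1P; left; ring.
Qed.

(** The box sum of the double series times [T] is the sum of the expected
    numbers of hits. *)
Lemma hits_box h T i j V : `|h|%N = (i + j)%N -> i = 0%N \/ j = 0%N ->
  `|\sum_(1 <= a < V.+1) \sum_(1 <= b < V.+1) f a * g b * (hits a b i j T)%:R
    - T%:R * box_sum (Cterm f g h) V| <=
  (A * B * \sum_(1 <= a < V.+1) \sum_(1 <= b < V.+1)
     negpow alpha a * negpow beta b * dev R a b i j T)%:C.
Proof.
move=> hij ij; rewrite /box_sum mulr_sumr -sumrB.
apply: le_trans (ler_norm_sum _ _ _) _; rewrite mulr_sumr rmorph_sum /=.
rewrite [leLHS]big_nat_cond [leRHS]big_nat_cond; apply: ler_sum => a /andP[/andP[a1 _] _].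
rewrite mulr_sumr -sumrB.
apply: le_trans (ler_norm_sum _ _ _) _; rewrite mulr_sumr rmorph_sum /=.
rewrite [leLHS]big_nat_cond [leRHS]big_nat_cond; apply: ler_sum => b /andP[/andP[b1 _] _].
have -> : T%:R * Cterm f g h (a, b) = f a * g b * (expected R a b i j T)%:C.
  rewrite /Cterm a1 b1 /= dvdzE absz_nat hij /expected; case: ifP => _; last by rewrite !mulr0.
  by rewrite rmorphM /= fmorphV !rmorph_nat mulrCA mulrA.
rewrite -mulrBr normrM mulrA rmorphM /dev.
apply: ler_pM => //; first exact: mul_bigO.
have -> : (hits a b i j T)%:R - (expected R a b i j T)%:C =
    ((hits a b i j T)%:R - expected R a b i j T)%:C :> R[i].
  by rewrite rmorphB rmorph_nat.
by rewrite normc_realE.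
Qed.

End Series.

End Reduction.

(** * The correlation sum *)

Theorem theorem2p2 (R : realType) (alpha beta : R)
    (alpha_gt0 : 0 < alpha) (le_alpha_beta : alpha <= beta) (A B : R) :
  exists K : R,
    forall (f g : nat -> R[i]),
      bigO_pow A alpha f -> bigO_pow B beta g ->
      (forall h : int, Cconverges f g h) /\
      (forall (x : R) (h : int), 2 <= x -> `|h|%:~R <= x / 2 ->
        `|shifted_sum f g x h - (x - (Hstart h)%:~R)%:C * Cseries f g h|
          <= (K * Eerr x alpha beta)%:C).
Proof.
have [K1 K10 dev_small] := dev_Eerr alpha_gt0 le_alpha_beta.
have [K2 K20 tail_small] := Eerr_tail beta alpha_gt0.
pose c : R := (1 + (ln 2)^-1) ^+ 2.
pose t := tail_const alpha beta.
exists (A * B * (K1 + 2 * t * K2 + (1 + 2 * t) * c)) => f g fA gB.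
have AB0 : 0 <= A * B by rewrite mulr_ge0 ?(bigO_pow_ge0 fA) ?(bigO_pow_ge0 gB).
have t0 : 0 <= t by exact: tail_const_ge0.
split=> [h|x h x2 hx]; first exact: (Cconverges_of_bigO alpha_gt0 le_alpha_beta fA gB).
have [T [i [j [ij hij [Ti Tj] Tx ->]]]] := shifted_sum_nat f g x2 hx.
have [V2 _ U1] := side_bounds x2.
set V := (side x * side x)%N in V2.
have V0 : (0 < V)%N by rewrite muln_gt0.
have {}Ti : (T + i <= V)%N by rewrite -(ler_nat R); apply: le_trans V2.
have {}Tj : (T + j <= V)%N by rewrite -(ler_nat R); apply: le_trans V2.
have TV : (T <= V)%N by apply: leq_trans Ti; rewrite leq_addr.
rewrite (conv1_shift_sum f g Ti Tj).
set S := \sum_(1 <= a < V.+1) _; set C := Cseries f g h.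
set D := box_sum (Cterm f g h) V.
have E0 := Eerr_ge0 alpha beta x2.
have e1 : `|S - T%:R * D| <= (A * B * (K1 * Eerr x alpha beta))%:C.
  apply: le_trans (hits_box fA gB _ _ hij ij) _.
  by rewrite lecR ler_wpM2l //; exact: dev_small.
have e2 : `|T%:R * (C - D)| <= (A * B * (2 * t * (K2 * Eerr x alpha beta)))%:C.
  rewrite normrM normr_nat.
  apply: (@le_trans _ _ (T%:R * (2 * (A * B * t * negpow alpha V))%:C)).
    rewrite ler_wpM2l //.
    exact: (Cseries_box alpha_gt0 le_alpha_beta fA gB h V0).
  rewrite -(rmorph_nat (real_complex R)) -rmorphM lecR.
  have -> : T%:R * (2 * (A * B * t * negpow alpha V)) =
    A * B * (2 * t * (T%:R * negpow alpha V)) by ring.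
  rewrite ler_wpM2l // ler_wpM2l ?mulr_ge0 //.
  apply: le_trans (tail_small x x2).
  by rewrite ler_wpM2r ?negpow_ge0 // ler_nat.
have e3 : `|(T%:R - (x - (Hstart h)%:~R))%:C * C| <=
    (A * B * ((1 + 2 * t) * (c * Eerr x alpha beta)))%:C.
  rewrite normrM normc_realE -[leLHS]mulrC.
  apply: (@le_trans _ _ `|C|); first by rewrite ler_piMr // lecR.
  apply: le_trans (Cseries_le alpha_gt0 le_alpha_beta fA gB h) _.
  rewrite lecR ler_wpM2l // ler_peMr ?Eerr_ge //.
  by rewrite addr_ge0 ?mulr_ge0.
set y := x - _ in e3 *.
have -> : S - y%:C * C = (S - T%:R * D) - T%:R * (C - D) + (T%:R - y)%:C * C.
  have -> : (T%:R - y)%:C = T%:R - y%:C by rewrite rmorphB rmorph_nat.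
  ring.
apply: le_trans (ler_normD _ _) _.
apply: le_trans (lerD (le_trans (ler_normB _ _) (lerD e1 e2)) e3) _.
by rewrite -!rmorphD lecR le_eqVlt; apply/predU1P; left; ring.
Qed.
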